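(* Let $(\mathfrak g_N,\mathfrak g_p\oplus\mathfrak g_q)$ be a symmetric pair of type BI, CII or DI(a), with $N\ge4$ if $\mathfrak g_N=\mathfrak{sp}_N$, and with $N\ge5$ and $q\ne2$ if $\mathfrak g_N=\mathfrak{so}_N$. Suppose $\mu(u)$ is associated to the tuple $(\alpha,P_1(u),\dots,P_n(u))$, put $\mathbf P=(P_1(u),\dots,P_n(u))$, and assume that the irreducible $X(\mathfrak g_N,\mathfrak g_p\oplus\mathfrak g_q)^{tw}$-module $V(\mu(u))$ is finite-dimensional. Then $2^{1-\delta}(\alpha-\tfrac N4)$ is an integer satisfying $$2^{1-\delta}(\alpha-\tfrac N4)\le A(\mathbf P,u)+\sum_{a=2}^{k+1}\deg P_a(u)+(1-2^{\delta-1})\deg P_{k+2}(u).$$ (When $\delta=1$ the last term has coefficient $0$ and is absent.)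
   Context: Notation. $N=2n$ or $2n+1$; $\mathfrak g_N$ is $\mathfrak{so}_N$ or (only if $N=2n$) $\mathfrak{sp}_N$. In $\pm,\mp$ the upper sign is for the orthogonal case, the lower for the symplectic case. $\delta=0$ if $\mathfrak g_N=\mathfrak{so}_N$, $\delta=1$ if $\mathfrak g_N=\mathfrak{sp}_N$. $\mathcal I_N=\{-n,\dots,-1,(0),1,\dots,n\}$ ($0$ omitted if $N=2n$), $\mathcal I_N^+=\{i\in\mathcal I_N:i\ge0\}$. $\theta_{ij}=1$ (orthogonal) or $\mathrm{sign}(i)\mathrm{sign}(j)$ (symplectic); $(E_{ij})^t=\theta_{ij}E_{-j,-i}$. $P=\sum E_{ij}\otimes E_{ji}$, $Q=P^{t_1}$, $\kappa=N/2\mp1$, $R(u)=I-u^{-1}P+(u-\kappa)^{-1}Q$. The extended Yangian $X(\mathfrak g_N)$ is generated by $t_{ij}^{(r)}$ ($i,j\in\mathcal I_N$, $r\ge1$) with relation $R(u-v)T_1(u)T_2(v)=T_2(v)T_1(u)R(u-v)$, $T(u)=\sum E_{ij}\otimes t_{ij}(u)$, $t_{ij}(u)=\delta_{ij}+\sum_{r\ge1}t_{ij}^{(r)}u^{-r}$. Symmetric pairs: $p+q=N$, $p\ge q>0$. Types: BI(a): $\mathfrak{so}_{2n+1}$, $q$ even; BI(b): $\mathfrak{so}_{2n+1}$, $q$ odd; CII: $\mathfrak{sp}_{2n}$, $q$ even; DI(a): $\mathfrak{so}_{2n}$, $q$ even; ''BI'' means BI(a) or BI(b). Set $\ell=\frac{N-q}2$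 for type BI(b), $\ell=\frac q2$ otherwise, $k=n-\ell$. $\mathcal G=(g_{ij})$ is diagonal; for BI(a), CII, DI(a): $g_{ii}=1$ if $|i|\le k$, $g_{ii}=-1$ if $|i|>k$; for BI(b): $g_{ii}=-1$ if $|i|\le k$, $g_{ii}=1$ if $|i|>k$. Let $d=\frac{p-q}4$, $\mathcal G(u)=\frac{dI-u\mathcal G}{d-u}$ (expanded in $u^{-1}$). $X(\mathfrak g_N,\mathfrak g_p\oplus\mathfrak g_q)^{tw}$ is the subalgebra of $X(\mathfrak g_N)$ generated by the coefficients $s_{ij}^{(r)}$, $r\ge1$, of the entries $s_{ij}(u)=g_{ij}+\sum_{r\ge1}s_{ij}^{(r)}u^{-r}$ of $S(u)=T(u-\kappa/2)\,\mathcal G(u)\,T^t(-u+\kappa/2)$. For $\mu(u)=(\mu_i(u))_{i\in\mathcal I_N^+}$, $\mu_i(u)\in g_{ii}+u^{-1}\mathbb C[[u^{-1}]]$, $M(\mu(u))$ is the quotient of $X(\mathfrak g_N,\mathfrak g_p\oplus\mathfrak g_q)^{tw}$ by the left ideal generated by all coefficients of $s_{ij}(u)$, $i<j$, and of $s_{ii}(u)-\mu_i(u)$, $i\in\mathcal I_N^+$; when non-trivial it has a unique irreducible quotient $V(\mu(u))$. Put $\widetilde\mu_i(u)=(2u-n+i)\mu_i(u)+\sum_{j=i+1}^n\mu_j(u)$, and $g(u)=[\pm]\frac{p+q-4u}{p-q-4u}$ with $[\pm]=-$ for type BI(b) and $+$ otherwise. Associated tuple. Let $P_1,\dots,P_n$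 be monic with $P_1(u)=P_1(-u+\kappa+2^\delta)$, $P_i(u)=P_i(-u+n-i+2)$ for $2\le i\le n$, and $\alpha\in\mathbb C$ with $P_{k+1}(\alpha)\ne0$. $\mu(u)$ is associated to $(\alpha,P_1(u),\dots,P_n(u))$ if: $\frac{\widetilde\mu_{i-1}(u)}{\widetilde\mu_i(u)}=\frac{P_i(u+1)}{P_i(u)}\big(\frac{\alpha-u}{\alpha+u-\ell}\big)^{\delta_{i,k+1}}$ for $2\le i\le n$; if $N=2n+1$, $\frac{\widetilde\mu_0(u)}{\widetilde\mu_1(u)}=\frac{P_1(u+1/2)}{P_1(u)}\big(\frac{\alpha-u}{\alpha+u-n}\big)^{\delta_{k,0}}$ and $u\,g(u)\widetilde\mu_0(\kappa-u)=(\kappa-u)g(\kappa-u)\widetilde\mu_0(u)$; if $N=2n$, $\frac{\widetilde\mu_1(\kappa-u)}{\widetilde\mu_{2^{1-\delta}}(u)}=\frac{g(\kappa-u)}{g(u)}\cdot\frac{P_1(u+2^\delta)}{P_1(u)}\cdot\frac{\kappa-u}u$. (Then $M(\mu(u))\neq 0$, so $V(\mu(u))$ exists.) $A(\mathbf P,u)=\deg P_1$ if $\mathfrak g_N=\mathfrak{sp}_{2n}$; $\frac12\deg P_1$ if $\mathfrak g_N=\mathfrak{so}_{2n+1}$; $\frac12(\deg P_1-\deg P_2)$ if $\mathfrak g_N=\mathfrak{so}_{2n}$. *)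

(* Defs.v *)
From HB Require Import structures.
From mathcomp Require Import all_boot all_order all_algebra.
From mathcomp Require Import boolp classical_sets functions fsbigop.
From mathcomp Require Import mxtens ring zify.
From mathcomp.multinomials Require Import monalg.

Set Implicit Arguments.
Unset Strict Implicit.
Unset Printing Implicit Defensive.

Import Order.TTheory GRing.Theory Num.Theory.

Local Open Scope classical_set_scope.
Local Open Scope ring_scope.

(* The ring A((u^-1)): [lcoef f k] is the coefficient of u^k, and only finitely
   many positive powers of u occur. *)
Record laurent (A : nzRingType) := Laurent {
  lcoef :> int -> A;
  laurent_bound : exists a : int, forall k : int, a < k -> lcoef k = 0
}.

Section LaurentRing.
Variable A : nzRingType.
Implicit Types f g h : laurent A.

Lemma laurentP f g : lcoef f =1 lcoef g -> f = g.
Proof.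
case: f g => [f bf] [g bg] /= /funext E; case: g / E bg => bg.
by rewrite (Prop_irrelevance bf bg).
Qed.

HB.instance Definition _ := gen_eqMixin (laurent A).
HB.instance Definition _ := gen_choiceMixin (laurent A).

Fact lzero_bound : exists a : int, forall k : int, a < k -> (fun=> 0 : A) k = 0.
Proof. by exists 0. Qed.
Definition lzero := Laurent lzero_bound.

Fact lopp_bound f :
  exists a : int, forall k : int, a < k -> (fun i => - f i) k = 0.
Proof. by case: f => f [a fa]; exists a => k /fa /= ->; rewrite oppr0. Qed.
Definition lopp f := Laurent (lopp_bound f).

Fact ladd_bound f g :
  exists a : int, forall k : int, a < k -> (fun i => f i + g i) k = 0.
Proof.
case: f g => [f [a fa]] [g [b gb]]; exists (Num.max a b) => k /=.
by rewrite gt_max => /andP[/fa -> /gb ->]; rewrite addr0.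
Qed.
Definition ladd f g := Laurent (ladd_bound f g).

Fact laddA : associative ladd.
Proof. by move=> f g h; apply: laurentP => k /=; rewrite addrA. Qed.
Fact laddC : commutative ladd.
Proof. by move=> f g; apply: laurentP => k /=; rewrite addrC. Qed.
Fact ladd0 : left_id lzero ladd.
Proof. by move=> f; apply: laurentP => k /=; rewrite add0r. Qed.
Fact laddN : left_inverse lzero lopp ladd.
Proof. by move=> f; apply: laurentP => k /=; rewrite addNr. Qed.

HB.instance Definition _ := GRing.isZmodule.Build (laurent A) laddA laddC ladd0 laddN.

Definition lmulc f g (k : int) : A := \sum_(i \in [set: int]) f i * g (k - i).

Definition convol (F G : nat -> A) (n : nat) : A :=
  \sum_(i < n.+1) F i * G (n - i)%N.

Lemma lmulcE f g (a b : int) :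
  (forall k, a < k -> f k = 0) -> (forall k, b < k -> g k = 0) ->
  forall n : nat,
  lmulc f g (a + b - n%:Z) =
  convol (fun i => f (a - i%:Z)) (fun i => g (b - i%:Z)) n.
Proof.
move=> fa gb n; rewrite /lmulc /convol.
pose s := [seq a - i%:Z | i <- iota 0 n.+1].
have us : uniq s.
  rewrite map_inj_uniq ?iota_uniq // => i j /addrI /oppr_inj [] //.
rewrite -(@fsbig_widen _ _ _ _ [set` s]) //; last first.
  move=> i [_ /= Ni]; have [/fa ->|ia] := ltP a i; first by rewrite mul0r.
  have [/gb ->|ib] := ltP b (a + b - n%:Z - i); first by rewrite mulr0.
  case: Ni; apply/mapP; exists `|a - i|%N.
    by rewrite mem_iota add0n ltnS /=; lia.
  by rewrite gez0_abs ?subr_ge0 // opprB addrC subrK.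
rewrite -fsbig_seq // big_map -[iota 0 n.+1]/(index_iota 0 n.+1) big_mkord.
apply: eq_bigr => i _; congr (f _ * g _).
by have := ltn_ord i; lia.
Qed.

Lemma lmulc_out f g (a b : int) :
  (forall k, a < k -> f k = 0) -> (forall k, b < k -> g k = 0) ->
  forall k, a + b < k -> lmulc f g k = 0.
Proof.
move=> fa gb k abk; rewrite /lmulc; apply: fsbig1 => i _.
have [/fa ->|ia] := ltP a i; first by rewrite mul0r.
by rewrite gb ?mulr0 //; lia.
Qed.

Fact lmul_bound f g :
  exists a : int, forall k : int, a < k -> lmulc f g k = 0.
Proof.
have [a fa] := laurent_bound f; have [b gb] := laurent_bound g.
by exists (a + b); apply: lmulc_out.
Qed.
Definition lmul f g := Laurent (lmul_bound f g).

Lemma convolA (F G H : nat -> A) n :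
  convol F (convol G H) n = convol (convol F G) H n.
Proof.
have cE (E E' : nat -> A) m k : (k <= m)%N ->
    convol E E' k = (\poly_(i < m.+1) E i * \poly_(i < m.+1) E' i)`_k.
  move=> km; rewrite coefM; apply: eq_bigr => i _.
  by rewrite !coef_poly !ltnS (leq_trans _ km) ?leq_ord //
    (leq_trans _ km) ?leq_subr.
transitivity ((\poly_(i < n.+1) F i * \poly_(i < n.+1) G i
                 * \poly_(i < n.+1) H i)`_n).
  rewrite -mulrA coefM; apply: eq_bigr => i _.
  by rewrite coef_poly ltn_ord (cE _ _ n) ?leq_subr.
rewrite coefM; apply: eq_bigr => i _.
by rewrite coef_poly ltnS leq_subr (cE _ _ n) ?leq_ord.
Qed.

Lemma laurent_ext h h' (a : int) :
  (forall k, a < k -> h k = 0) -> (forall k, a < k -> h' k = 0) ->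
  (forall n : nat, h (a - n%:Z) = h' (a - n%:Z)) -> h = h'.
Proof.
move=> ha h'a E; apply: laurentP => k.
have [ak|ka] := ltP a k; first by rewrite ha ?h'a.
by have := E `|a - k|%N; rewrite gez0_abs ?subr_ge0 // opprB addrC subrK.
Qed.

Fact lmulA : associative lmul.
Proof.
move=> f g h; have [a fa] := laurent_bound f; have [b gb] := laurent_bound g.
have [c hc] := laurent_bound h.
have bgh : forall k, b + c < k -> lmul g h k = 0 by exact: lmulc_out.
have bfg : forall k, a + b < k -> lmul f g k = 0 by exact: lmulc_out.
apply: (@laurent_ext _ _ (a + b + c)).
- by move=> k k1; apply: (lmulc_out fa bgh); rewrite addrA.
- exact: (lmulc_out bfg hc).
move=> n; rewrite /= (lmulcE bfg hc) -[a + b + c]addrA (lmulcE fa bgh).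
rewrite (_ : (fun i : nat => lmul g h _) =
   convol (fun i => g (b - i%:Z)) (fun i => h (c - i%:Z))); last first.
  by apply/funext => i /=; rewrite (lmulcE gb hc).
rewrite (_ : (fun i : nat => lmul f g _) =
   convol (fun i => f (a - i%:Z)) (fun i => g (b - i%:Z))); last first.
  by apply/funext => i /=; rewrite (lmulcE fa gb).
exact: convolA.
Qed.

Fact lmono_bound (c : A) (m : int) :
  exists a : int, forall k : int, a < k -> (fun i => c *+ (i == m)) k = 0.
Proof. by exists m => k; rewrite lt_neqAle eq_sym => /andP[/negPf ->]. Qed.
Definition lmono (c : A) (m : int) := Laurent (lmono_bound c m).

Lemma lmono_mul (c : A) m f k : lmul (lmono c m) f k = c * f (k - m).
Proof.
rewrite /= /lmulc -(@fsbig_widen _ _ _ _ [set m]) //; last first.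
  by move=> i [_ /eqP/negPf /= ->]; rewrite mul0r.
by rewrite fsbig_set1 /= eqxx.
Qed.

Lemma mul_lmono (c : A) m f k : lmul f (lmono c m) k = f (k - m) * c.
Proof.
rewrite /= /lmulc -(@fsbig_widen _ _ _ _ [set k - m]) //; last first.
  move=> i [_ /= /eqP]; rewrite -subr_eq0 => ikm.
  by rewrite (_ : (k - i == m) = false) ?mulr0 //; apply/negbTE; apply: contra ikm; lia.
by rewrite fsbig_set1 /= (_ : (k - _ == m)) //; lia.
Qed.

Definition lone := lmono 1 0.

Fact lmul1 : left_id lone lmul.
Proof. by move=> f; apply: laurentP => k; rewrite lmono_mul subr0 mul1r. Qed.
Fact lmulr1 : right_id lone lmul.
Proof. by move=> f; apply: laurentP => k; rewrite mul_lmono subr0 mulr1. Qed.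

Lemma convolDl (F F' G : nat -> A) n :
  convol (fun i => F i + F' i) G n = convol F G n + convol F' G n.
Proof. by rewrite -big_split; apply: eq_bigr => i _; rewrite mulrDl. Qed.
Lemma convolDr (F F' G : nat -> A) n :
  convol G (fun i => F i + F' i) n = convol G F n + convol G F' n.
Proof. by rewrite -big_split; apply: eq_bigr => i _; rewrite mulrDr. Qed.

Lemma laurent_bound2 f g : exists a : int,
  (forall k, a < k -> f k = 0) /\ (forall k, a < k -> g k = 0).
Proof.
have [a fa] := laurent_bound f; have [b gb] := laurent_bound g.
by exists (Num.max a b); split=> k; rewrite gt_max => /andP[? ?]; auto.
Qed.

Fact lmulDl : left_distributive lmul ladd.
Proof.
move=> f g h; have [a [fa ga]] := laurent_bound2 f g.
have [c hc] := laurent_bound h.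
have fga : forall k, a < k -> ladd f g k = 0.
  by move=> k ak /=; rewrite fa // ga // addr0.
apply: (@laurent_ext _ _ (a + c)).
- exact: lmulc_out.
- by move=> k k1 /=; rewrite !(@lmulc_out _ _ a c) ?addr0.
by move=> n /=; rewrite !(@lmulcE _ _ a c) // convolDl.
Qed.

Fact lmulDr : right_distributive lmul ladd.
Proof.
move=> h f g; have [a [fa ga]] := laurent_bound2 f g.
have [c hc] := laurent_bound h.
have fga : forall k, a < k -> ladd f g k = 0.
  by move=> k ak /=; rewrite fa // ga // addr0.
apply: (@laurent_ext _ _ (c + a)).
- exact: lmulc_out.
- by move=> k k1 /=; rewrite !(@lmulc_out _ _ c a) ?addr0.
by move=> n /=; rewrite !(@lmulcE _ _ c a) // convolDr.
Qed.

Fact lone_neq0 : lone != lzero.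
Proof.
apply/eqP => /(congr1 (fun f => lcoef f 0)) /= /eqP.
by rewrite oner_eq0.
Qed.

HB.instance Definition _ := GRing.Zmodule_isNzRing.Build (laurent A)
  lmulA lmul1 lmulr1 lmulDl lmulDr lone_neq0.

Lemma lcoefM f g k : (f * g) k = \sum_(i \in [set: int]) f i * g (k - i).
Proof. by []. Qed.

End LaurentRing.

Section LaurentField.
Variable C : fieldType.

Fact lmulC (A : comNzRingType) : commutative (@lmul A).
Proof.
move=> f g; have [a fa] := laurent_bound f; have [b gb] := laurent_bound g.
apply: (@laurent_ext _ _ _ (a + b)).
- exact: lmulc_out.
- by rewrite addrC; exact: lmulc_out.
move=> n /=; rewrite (lmulcE fa gb) [a + b]addrC (lmulcE gb fa) /convol.
rewrite (reindex_inj rev_ord_inj); apply: eq_bigr => i _.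
by rewrite mulrC /= subSS subKn // -ltnS.
Qed.

HB.instance Definition _ (A : comNzRingType) :=
  GRing.PzRing_hasCommutativeMul.Build (laurent A) (@lmulC A).

Section Inverse.
Variable F : nat -> C.
Fixpoint inv_seq (n : nat) : seq C :=
  if n is m.+1 then
    rcons (inv_seq m)
      ((F 0)^-1 * ((m == 0)%:R - \sum_(i < m) F (m - i)%N * (inv_seq m)`_i))
  else [::].
Lemma size_inv_seq n : size (inv_seq n) = n.
Proof. by elim: n => //= n IH; rewrite size_rcons IH. Qed.
Lemma nth_inv_seq n m i : (i < n <= m)%N -> (inv_seq m)`_i = (inv_seq n)`_i.
Proof.
elim: m => [|m IH] /andP[ilt nm]; first by move: nm ilt; rewrite leqn0 => /eqP->.
move: nm; rewrite leq_eqVlt => /predU1P[->//|]; rewrite ltnS => nm.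
by rewrite /= nth_rcons size_inv_seq (leq_trans ilt nm) IH ?ilt.
Qed.
Lemma convol_inv (F0 : F 0 != 0) n :
  convol F (fun i => (inv_seq i.+1)`_i) n = (n == 0)%:R.
Proof.
rewrite /convol (reindex_inj rev_ord_inj) big_ord_recr /= !subnn !subn0.
rewrite nth_rcons size_inv_seq ltnn eqxx mulVKf //.
rewrite (eq_bigr (fun i : 'I_n => F (n - i)%N * (inv_seq n)`_i)).
  by rewrite addrC subrK.
move=> i _; have := ltn_ord i => ilt; rewrite -/(inv_seq _.+1).
rewrite (_ : (n - (n.+1 - i.+1))%N = i); last by lia.
rewrite (_ : (n.+1 - i.+1)%N = (n - i)%N); last by lia.
by rewrite -(@nth_inv_seq i.+1 n i) //= ltnS leqnn ltn_ord.
Qed.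
End Inverse.

Lemma laurent_deg (f : laurent C) : f != 0 ->
  exists a : int, f a != 0 /\ forall k, a < k -> f k = 0.
Proof.
move=> fn0; have [b fb] := laurent_bound f.
have ex : exists n : nat, f (b - n%:Z) != 0.
  apply/not_existsP => H; case/eqP: fn0.
  apply: (@laurent_ext _ _ _ b) => // n.
  by have /negP/negPn/eqP := H n.
exists (b - (ex_minn ex)%:Z); case: ex_minnP => n fn mn; split=> // k nk.
have [/fb //|kb] := ltP b k; apply/eqP; apply/negPn/negP => fk.
have := mn `|b - k|%N; rewrite (_ : b - _ = k); last by lia.
by move=> /(_ fk); lia.
Qed.

Lemma laurent_inv_ex (f : laurent C) : f != 0 -> exists g : laurent C, g * f = 1.
Proof.
case/laurent_deg => a [fa0 fa].
pose F i := f (a - i%:Z).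
have F0 : F 0%N != 0 by rewrite /F subr0.
pose gc (k : int) : C :=
  if - a < k then 0 else (inv_seq F (absz (k + a)).+1)`_(absz (k + a)).
have gb : exists b : int, forall k : int, b < k -> gc k = 0.
  by exists (- a) => k ak; rewrite /gc ak.
exists (Laurent gb); rewrite mulrC.
have gb' : forall k : int, - a < k -> Laurent gb k = 0.
  by move=> k ak; rewrite /= /gc ak.
apply: (@laurent_ext _ _ _ (a + - a)).
- exact: lmulc_out.
- by move=> k; rewrite subrr => k0 /=; rewrite gt_eqF.
move=> n; rewrite [LHS](lmulcE fa gb').
rewrite (_ : (fun i : nat => Laurent gb _) = (fun i => (inv_seq F i.+1)`_i)).
  by rewrite (convol_inv F0) subrr sub0r; case: n.
apply/funext => i /=; rewrite /gc ltrBrDr addrC.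
by rewrite (_ : (_ < _) = false) 1?(_ : absz _ = i) //; lia.
Qed.

Definition linv (f : laurent C) : laurent C :=
  if pselect (exists g : laurent C, g * f = 1) is left e then projT1 (cid e)
  else 0.

Fact lmulVf (f : laurent C) : f != 0 -> linv f * f = 1.
Proof.
by move=> /laurent_inv_ex e; rewrite /linv; case: pselect => // e'; case: cid.
Qed.
Fact linv0 : linv 0 = 0.
Proof.
rewrite /linv; case: pselect => // e; exfalso; case: e => g /eqP.
by rewrite mulr0 eq_sym oner_eq0.
Qed.

HB.instance Definition _ := GRing.ComNzRing_isField.Build (laurent C) lmulVf linv0.

End LaurentField.

Section LaurentMaps.
Variables A B : nzRingType.

Definition lconst (c : A) : laurent A := lmono c 0.

Definition lvar : laurent A := lmono 1 1.

Fact lmap_bound (phi : {additive A -> B}) (f : laurent A) :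
  exists a : int, forall k : int, a < k -> (fun i => phi (f i)) k = 0.
Proof. by have [a fa] := laurent_bound f; exists a => k /fa ->; rewrite raddf0. Qed.
Definition lmap (phi : {additive A -> B}) (f : laurent A) : laurent B :=
  Laurent (lmap_bound phi f).

Fact lconst_zmod_morphism : zmod_morphism lconst.
Proof. by move=> x y; apply: laurentP => k /=; rewrite mulrnBl. Qed.
HB.instance Definition _ :=
  GRing.isZmodMorphism.Build A (laurent A) lconst lconst_zmod_morphism.

Fact lconst_monoid_morphism : monoid_morphism lconst.
Proof.
split=> // x y; apply: laurentP => k; rewrite [RHS]lmono_mul subr0 /=.
by case: eqP; rewrite ?mulr0.
Qed.
HB.instance Definition _ :=
  GRing.isMonoidMorphism.Build A (laurent A) lconst lconst_monoid_morphism.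

Fact lmap_zmod_morphism (phi : {additive A -> B}) : zmod_morphism (lmap phi).
Proof. by move=> x y; apply: laurentP => k /=; rewrite raddfB. Qed.
HB.instance Definition _ (phi : {additive A -> B}) :=
  GRing.isZmodMorphism.Build (laurent A) (laurent B) (lmap phi)
    (lmap_zmod_morphism phi).

Fact lmap_monoid_morphism (phi : {rmorphism A -> B}) : monoid_morphism (lmap phi).
Proof.
split=> [|f g].
  by apply: laurentP => k /=; case: (k == 0); rewrite ?rmorph1 ?rmorph0.
have [a fa] := laurent_bound f; have [b gb] := laurent_bound g.
have fa' k : a < k -> lmap phi f k = 0 by move=> /fa /= ->; rewrite rmorph0.
have gb' k : b < k -> lmap phi g k = 0 by move=> /gb /= ->; rewrite rmorph0.
have fg := lmulc_out fa gb.
apply: (@laurent_ext _ _ _ (a + b)).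
- by move=> k /fg /= ->; rewrite rmorph0.
- exact: lmulc_out.
move=> n; rewrite [RHS](lmulcE fa' gb') /= (lmulcE fa gb) rmorph_sum.
by apply: eq_bigr => i _; rewrite rmorphM.
Qed.
HB.instance Definition _ (phi : {rmorphism A -> B}) :=
  GRing.isMonoidMorphism.Build (laurent A) (laurent B) (lmap phi)
    (lmap_monoid_morphism phi).

(* The coefficient of u^(k-j) c^j in (u + c)^k, for k of either sign. *)
Definition binz (k : int) (j : nat) : int :=
  match k with
  | Posz n => 'C(n, j)%:Z
  | Negz n => (-1) ^+ j * 'C(n + j, j)%:Z
  end.

Definition ltransc (c : A) (f : laurent A) (m : int) : A :=
  \sum_(j \in [set: nat]) f (m + j%:Z) * (c ^+ j *~ binz (m + j%:Z) j).

Fact ltransc_bound (c : A) (f : laurent A) :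
  exists a : int, forall k : int, a < k -> ltransc c f k = 0.
Proof.
have [a fa] := laurent_bound f; exists a => k ak; apply: fsbig1 => j _.
by rewrite fa ?mul0r //; lia.
Qed.

(* [ltrans c f] is f(u + c) and [lrefl c f] is f(c - u), both expanded in u^-1,
   for c central in A. *)
Definition ltrans (c : A) (f : laurent A) : laurent A :=
  Laurent (ltransc_bound c f).

Fact lrefl_bound (c : A) (f : laurent A) :
  exists a : int, forall k : int, a < k ->
    (fun m => (-1) ^+ absz m * ltransc c f m) k = 0.
Proof. by have [a fa] := ltransc_bound c f; exists a => k /fa ->; rewrite mulr0. Qed.
Definition lrefl (c : A) (f : laurent A) : laurent A :=
  Laurent (lrefl_bound c f).

End LaurentMaps.
Arguments lvar {A}.

Definition peval (C : fieldType) (p : {poly C}) (w : laurent C) : laurent C :=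
  (map_poly (@lconst C) p).[w].

Section Submodule.
Variables (R : pzRingType) (V : lmodType R) (S : set V).

Definition submod_gen : {pred V} := fun x =>
  `[< forall W : {pred V}, submod_closed W ->
        (forall y, S y -> y \in W) -> x \in W >].

Fact submod_gen_closed : submod_closed submod_gen.
Proof.
split=> [|a x y /asboolP Hx /asboolP Hy].
  by apply/asboolP => W [W0 _].
by apply/asboolP => W cW SW; case: (cW) => _; apply; [exact: Hx | exact: Hy].
Qed.
HB.instance Definition _ := GRing.isSubmodClosed.Build R V submod_gen
  submod_gen_closed.

Definition quot_mod : Type := Quotient.quot submod_gen.
HB.instance Definition _ := GRing.Zmodule.on quot_mod.

Definition quot_proj (x : V) : quot_mod := (\pi_(Quotient.quot submod_gen) x)%qT.

Lemma quot_projP x y : quot_proj x = quot_proj y <-> x - y \in submod_gen.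
Proof. by rewrite /quot_proj; split=> [/eqP|H]; [|apply/eqP];
  rewrite -Quotient.idealrBE. Qed.

Lemma quot_projB x y : quot_proj (x - y) = quot_proj x - quot_proj y.
Proof. exact: raddfB. Qed.

Lemma quot_proj_repr (x : quot_mod) : quot_proj (repr x) = x.
Proof. exact: reprK. Qed.

Definition quot_scale (a : R) (x : quot_mod) : quot_mod :=
  quot_proj (a *: repr x).

Lemma quot_scaleE a x : quot_scale a (quot_proj x) = quot_proj (a *: x).
Proof.
apply/quot_projP; rewrite -scalerBr rpredZ //; apply/quot_projP.
exact: quot_proj_repr.
Qed.
Lemma quot_projD x y : quot_proj (x + y) = quot_proj x + quot_proj y.
Proof. exact: raddfD. Qed.

Fact quot_scaleA a b x : quot_scale a (quot_scale b x) = quot_scale (a * b) x.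
Proof. by rewrite -[x]quot_proj_repr !quot_scaleE scalerA. Qed.
Fact quot_scale1 : left_id 1 quot_scale.
Proof. by move=> x; rewrite -[x]quot_proj_repr !quot_scaleE scale1r. Qed.
Fact quot_scaleDr : right_distributive quot_scale +%R.
Proof.
move=> a x y; rewrite -[x]quot_proj_repr -[y]quot_proj_repr.
by rewrite -quot_projD !quot_scaleE scalerDr quot_projD.
Qed.
Fact quot_scaleDl x : {morph quot_scale^~ x : a b / a + b}.
Proof.
move=> a b; rewrite -[x]quot_proj_repr.
by rewrite !quot_scaleE scalerDl quot_projD.
Qed.
HB.instance Definition _ := GRing.Zmodule_isLmodule.Build R quot_mod
  quot_scaleA quot_scale1 quot_scaleDr quot_scaleDl.

End Submodule.

Section Algebra.
Variables (C : comNzRingType) (A : lalgType C) (S : set A).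

Definition ideal_closed (I : {pred A}) :=
  [/\ zmod_closed I, (forall a x, x \in I -> a * x \in I)
    & (forall a x, x \in I -> x * a \in I)].

Definition ideal_gen : {pred A} := fun x =>
  `[< forall I : {pred A}, ideal_closed I ->
        (forall y, S y -> y \in I) -> x \in I >].

Fact ideal_gen_closed : ideal_closed ideal_gen.
Proof.
split.
- split=> [|x y /asboolP Hx /asboolP Hy]; apply/asboolP => I cI SI.
    by case: (cI) => -[].
  by case: (cI) => -[_ IB] _ _; apply: IB; [exact: Hx | exact: Hy].
- move=> a x /asboolP Hx; apply/asboolP => I cI SI.
  by case: (cI) => _ Il _; apply: Il; exact: Hx.
- move=> a x /asboolP Hx; apply/asboolP => I cI SI.
  by case: (cI) => _ _ Ir; apply: Ir; exact: Hx.
Qed.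

Definition quot_alg : Type := @quot_mod C A [set x | x \in ideal_gen].
HB.instance Definition _ := GRing.Lmodule.on quot_alg.

Definition alg_proj : A -> quot_alg := @quot_proj C A [set x | x \in ideal_gen].

Lemma alg_projP x y : alg_proj x = alg_proj y <-> x - y \in ideal_gen.
Proof.
rewrite /alg_proj quot_projP; have [[I0 IB] Il Ir] := ideal_gen_closed.
split=> [/asboolP|H]; last by apply/asboolP => W _; apply.
apply=> //; split=> // a z t zI tI.
have azI : a *: z \in ideal_gen by rewrite -[z]mul1r scalerAl; exact: Il.
by rewrite -[t]opprK; apply: (IB) => //; rewrite -sub0r; apply: IB.
Qed.

Fact alg_proj_linear : linear alg_proj.
Proof.
move=> a x y; rewrite /alg_proj quot_projD; congr (_ + _).
by rewrite -quot_scaleE.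
Qed.
HB.instance Definition _ := GRing.isLinear.Build C A quot_alg *:%R alg_proj
  alg_proj_linear.

Lemma alg_proj_repr (x : quot_alg) : alg_proj (repr x) = x.
Proof. exact: quot_proj_repr. Qed.

Definition quot_mul (x y : quot_alg) : quot_alg := alg_proj (repr x * repr y).

Lemma quot_mulE x y : quot_mul (alg_proj x) (alg_proj y) = alg_proj (x * y).
Proof.
have [[I0 IB] Il Ir] := ideal_gen_closed.
have Hx : repr (alg_proj x) - x \in ideal_gen.
  by apply/alg_projP; exact: alg_proj_repr.
have Hy : repr (alg_proj y) - y \in ideal_gen.
  by apply/alg_projP; exact: alg_proj_repr.
apply/alg_projP; move: (repr (alg_proj x)) (repr (alg_proj y)) Hx Hy => x' y' Hx Hy.
rewrite (_ : _ - _ = (x' - x) * y' - x * (- (y' - y))); last first.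
  by rewrite mulrN opprK mulrBl mulrBr addrA subrK.
apply: (IB); first exact: Ir.
by rewrite mulrN -sub0r; apply: IB => //; exact: Il.
Qed.

Definition quot_one : quot_alg := alg_proj 1.

Fact quot_mulA : associative quot_mul.
Proof.
move=> x y z; rewrite -[x]alg_proj_repr -[y]alg_proj_repr -[z]alg_proj_repr.
by rewrite !quot_mulE mulrA.
Qed.
Fact quot_mul1 : left_id quot_one quot_mul.
Proof. by move=> x; rewrite -[x]alg_proj_repr quot_mulE mul1r. Qed.
Fact quot_mulr1 : right_id quot_one quot_mul.
Proof. by move=> x; rewrite -[x]alg_proj_repr quot_mulE mulr1. Qed.
Fact quot_mulDl : left_distributive quot_mul +%R.
Proof.
move=> x y z; rewrite -[x]alg_proj_repr -[y]alg_proj_repr -[z]alg_proj_repr.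
by rewrite -linearD !quot_mulE mulrDl linearD.
Qed.
Fact quot_mulDr : right_distributive quot_mul +%R.
Proof.
move=> x y z; rewrite -[x]alg_proj_repr -[y]alg_proj_repr -[z]alg_proj_repr.
by rewrite -linearD !quot_mulE mulrDr linearD.
Qed.
HB.instance Definition _ := GRing.Zmodule_isPzRing.Build quot_alg
  quot_mulA quot_mul1 quot_mulr1 quot_mulDl quot_mulDr.

Fact alg_proj_monoid_morphism : monoid_morphism alg_proj.
Proof. by split=> // x y; rewrite -quot_mulE. Qed.
HB.instance Definition _ := GRing.isMonoidMorphism.Build A quot_alg alg_proj
  alg_proj_monoid_morphism.

Fact quot_scaleAl (a : C) (x y : quot_alg) : a *: (x * y) = a *: x * y.
Proof.
rewrite -[x]alg_proj_repr -[y]alg_proj_repr.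
by rewrite -rmorphM -!linearZ -rmorphM /= scalerAl.
Qed.

Lemma quot_alg_neq0 (I : {pred A}) :
  ideal_closed I -> (forall y, S y -> y \in I) -> 1 \notin I ->
  (1 : quot_alg) != 0.
Proof.
move=> cI SI; apply: contra => /eqP.
rewrite -(rmorph1 alg_proj) -(rmorph0 alg_proj) => /alg_projP.
by rewrite subr0 => /asboolP; apply.
Qed.

Definition subalg_gen : {pred A} := fun x =>
  `[< forall B : {pred A}, subalg_closed B ->
        (forall y, S y -> y \in B) -> x \in B >].

Fact subalg_gen_closed : subalg_closed subalg_gen.
Proof.
split.
- by apply/asboolP => B [].
- move=> a x y /asboolP Hx /asboolP Hy; apply/asboolP => B cB SB.
  by case: (cB) => _ BL _; apply: BL; [exact: Hx | exact: Hy].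
- move=> x y /asboolP Hx /asboolP Hy; apply/asboolP => B cB SB.
  by case: (cB) => _ _ BM; apply: BM; [exact: Hx | exact: Hy].
Qed.
HB.instance Definition _ := GRing.isSubalgClosed.Build C A subalg_gen
  subalg_gen_closed.

(* The unital subalgebra generated by S, as an algebra in its own right. *)
Record subalg := Subalg { sub_val :> A; subalgP : sub_val \in subalg_gen }.
HB.instance Definition _ := [isSub for sub_val].
HB.instance Definition _ := [Choice of subalg by <:].
HB.instance Definition _ := [SubChoice_isSubLalgebra of subalg by <:].

End Algebra.

Inductive pair_type := BIa | BIb | CII | DIa.

Definition is_BI (ty : pair_type) : bool :=
  match ty with BIa | BIb => true | _ => false end.
Definition is_BIb (ty : pair_type) : bool :=
  if ty is BIb then true else false.
Definition is_CII (ty : pair_type) : bool :=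
  if ty is CII then true else false.

(* N = 2n + 1 in type BI and N = 2n otherwise, p = N - q, p >= q > 0. *)
Record sym_pair := SymPair {
  sp_type : pair_type;
  sp_n : nat;
  sp_q : nat;
  sp_q_gt0 : (0 < sp_q)%N;
  sp_q_le : (sp_q.*2 <= sp_n.*2 + is_BI sp_type)%N;
  sp_q_odd : odd sp_q = is_BIb sp_type
}.

Definition sp_N (s : sym_pair) : nat := (sp_n s).*2 + is_BI (sp_type s).
Definition sp_p (s : sym_pair) : nat := sp_N s - sp_q s.
Definition sp_delta (s : sym_pair) : nat := is_CII (sp_type s).
Definition sp_l (s : sym_pair) : nat :=
  if is_BIb (sp_type s) then (sp_N s - sp_q s)./2 else (sp_q s)./2.
Definition sp_k (s : sym_pair) : nat := sp_n s - sp_l s.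

(* The index set {-n, ..., n} (without 0 if N is even) is modelled by 'I_N in
   increasing order: [lab i] is the index at position i, and the index
   - lab i is at position [rev_ord i]. *)
Definition lab (s : sym_pair) (i : 'I_(sp_N s)) : int :=
  if is_BI (sp_type s) || (i < sp_n s)%N then i%:Z - (sp_n s)%:Z
  else i.+1%:Z - (sp_n s)%:Z.

Definition theta (s : sym_pair) (i j : 'I_(sp_N s)) : int :=
  if is_CII (sp_type s) then sgz (lab i) * sgz (lab j) else 1.

(* The diagonal entry g_ii of the matrix G. *)
Definition gsign (s : sym_pair) (i : int) : int :=
  if is_BIb (sp_type s) then (if (absz i <= sp_k s)%N then -1 else 1)
  else (if (absz i <= sp_k s)%N then 1 else -1).

Section ExtendedYangian.
Variables (C : fieldType) (s : sym_pair).
Notation N := (sp_N s).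

Definition kappa : C := N%:R / 2 + (if is_CII (sp_type s) then 1 else -1).

(* (E_ij)^t = theta_ij E_(-j,-i), so the (a, b) entry of A^t is
   theta_(-b,-a) A_(-b,-a). *)
Definition mxt (A : nzRingType) (M : 'M[A]_N) : 'M[A]_N :=
  \matrix_(a, b) ((theta (rev_ord b) (rev_ord a))%:~R * M (rev_ord b) (rev_ord a)).

Definition Pmx (A : nzRingType) : 'M[A]_(N * N) :=
  \sum_i \sum_j delta_mx i j *t delta_mx j i.
Definition Qmx (A : nzRingType) : 'M[A]_(N * N) :=
  \sum_i \sum_j mxt (delta_mx i j) *t delta_mx j i.

(* Two-variable series live in A((v^-1))((u^-1)); over a field C this is a
   field, in which 1/(u - v) and 1/(u - v - kappa) are expanded in u^-1. *)
Definition uvar (A : nzRingType) : laurent (laurent A) := lvar.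
Definition vvar (A : nzRingType) : laurent (laurent A) := lconst lvar.

Definition Rmx : 'M[laurent (laurent C)]_(N * N) :=
  1%:M - (uvar C - vvar C)^-1 *: Pmx _
  + (uvar C - vvar C - lconst (lconst kappa))^-1 *: Qmx _.

(* [t i j r] stands for t_ij^(r+1). *)
Definition tcoef (A : nzRingType) (t : 'I_N -> 'I_N -> nat -> A) (i j : 'I_N)
    (k : int) : A :=
  match k with
  | Posz 0 => (i == j)%:R
  | Posz _.+1 => 0
  | Negz r => t i j r
  end.

Fact tcoef_bound (A : nzRingType) (t : 'I_N -> 'I_N -> nat -> A) (i j : 'I_N) :
  exists a : int, forall k : int, a < k -> tcoef t i j k = 0.
Proof. by exists 0; case=> [[|k]|k]. Qed.

Definition Tmx (A : nzRingType) (t : 'I_N -> 'I_N -> nat -> A) :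
    'M[laurent A]_N :=
  \matrix_(i, j) Laurent (tcoef_bound t i j).

Definition RTT (A : lalgType C) (t : 'I_N -> 'I_N -> nat -> A) :
    'M[laurent (laurent A)]_(N * N) :=
  let Ruv := map_mx (lmap (lmap (in_alg A))) Rmx in
  let T1u := map_mx (lmap (@lconst A)) (Tmx t) *t 1%:M in
  let T2v := 1%:M *t map_mx (@lconst (laurent A)) (Tmx t) in
  Ruv *m T1u *m T2v - T2v *m T1u *m Ruv.

Definition generator := ('I_N * 'I_N * nat)%type.
Definition free_alg := {malg C[{fmonom generator}]}.

Definition free_t (i j : 'I_N) (r : nat) : free_alg :=
  << fmu ((i, j, r) : generator) >>.

Definition RTT_relations : set free_alg :=
  [set x | exists i j (a b : int), x = RTT free_t i j a b].

Lemma RTT_map0 (A : lalgType C) (t : 'I_N -> 'I_N -> nat -> A)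
    (phi : {rmorphism A -> C}) :
  (forall i j r, phi (t i j r) = 0) ->
  map_mx (lmap (lmap phi)) (RTT t) = 0.
Proof.
move=> t0.
have T0 i j k : phi (tcoef t i j k) = (k == 0)%:R * (i == j)%:R.
  by case: k => [[|k]|k]; rewrite /= ?t0 ?rmorph0 ?mul0r // rmorph_nat mul1r.
have T1 : map_mx (lmap (lmap phi)) (map_mx (lmap (@lconst A)) (Tmx t)) = 1%:M.
  apply/matrixP => i j; rewrite !mxE; apply: laurentP => k; apply: laurentP => l.
  rewrite /= raddfMn /= T0.
  case: (i == j); rewrite /= ?mulr1 ?mulr0 ?mul0rn //.
  by case: (k == 0); rewrite /= ?mul0rn.
have T2 : map_mx (lmap (lmap phi)) (map_mx (@lconst (laurent A)) (Tmx t)) = 1%:M.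
  apply/matrixP => i j; rewrite !mxE; apply: laurentP => k; apply: laurentP => l.
  transitivity ((k == 0)%:R * ((l == 0)%:R * (i == j)%:R) : C).
    by rewrite /=; case: (k == 0); rewrite ?mul1r ?mul0r /= ?T0 ?rmorph0.
  case: (i == j); rewrite /= ?mulr1 ?mulr0 //.
  by case: (k == 0); rewrite /= ?mul1r ?mul0r.
rewrite /RTT map_mxB !map_mxM !map_mxT T1 T2 !map_mx1.
have -> (B : nzRingType) : (1%:M *t 1%:M : 'M[B]_(N * N)) = 1%:M.
  apply/matrixP => i j; case: (mxtens_indexP i) => i0 i1.
  case: (mxtens_indexP j) => j0 j1; rewrite tensmxE !mxE.
  rewrite (can_eq (@mxtens_indexK _ _)) xpair_eqE.
  by case: (i0 == j0); rewrite ?mul1r ?mul0r.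
by rewrite !mul1mx !mulmx1 subrr.
Qed.

Lemma RTT_proper : exists I : {pred free_alg},
  [/\ ideal_closed I, (forall x, RTT_relations x -> x \in I) & 1 \notin I].
Proof.
pose eps : {rmorphism free_alg -> C} := mcoeff mone.
exists (fun x => eps x == 0); split.
- split=> [|a x|a x].
  + by split=> [|x y /eqP x0 /eqP y0]; apply/eqP; rewrite ?rmorph0 // rmorphB x0 y0 subr0.
  + by move=> /eqP x0; apply/eqP; rewrite rmorphM x0 mulr0.
  + by move=> /eqP x0; apply/eqP; rewrite rmorphM x0 mul0r.
- move=> x [i [j [a [b ->]]]]; apply/eqP.
  have t0 i' j' r : eps (free_t i' j' r) = 0.
    rewrite /free_t /= mcoeffU1; case: eqP => // /(congr1 (fun m => size (fmonom_val m))).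
    by rewrite fm1 /fmu fmE.
  have := RTT_map0 t0; move/matrixP/(_ i j); rewrite mxE [RHS]mxE.
  by move/(congr1 (fun f : laurent (laurent C) => f a b)).
by rewrite unfold_in rmorph1 oner_eq0.
Qed.

Definition Yangian : Type := quot_alg RTT_relations.
HB.instance Definition _ := GRing.PzRing.on Yangian.
HB.instance Definition _ := GRing.Lmodule.on Yangian.

Fact Yangian_neq0 : (1 : Yangian) != 0.
Proof. by have [I [cI RI I1]] := RTT_proper; exact: quot_alg_neq0 I1. Qed.
HB.instance Definition _ := GRing.PzSemiRing_isNonZero.Build Yangian Yangian_neq0.
HB.instance Definition _ := GRing.Lmodule_isLalgebra.Build C Yangian
  (@quot_scaleAl C free_alg RTT_relations).

End ExtendedYangian.

Section TwistedYangian.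
Variables (C : fieldType) (s : sym_pair).
Notation N := (sp_N s).
Notation n := (sp_n s).
Notation p := (sp_p s).
Notation q := (sp_q s).
Notation k := (sp_k s).
Notation l := (sp_l s).
Notation delta := (sp_delta s).
Notation kappa := (kappa C s).
Notation X := (Yangian C s).
Notation u := (@lvar C).

Definition Gmx : 'M[C]_N := diag_mx (\row_i (gsign s (lab i))%:~R).

Definition Gumx : 'M[laurent C]_N :=
  let d := lconst ((p%:R - q%:R) / 4) in
  (d - u)^-1 *: (d%:M - u *: map_mx (@lconst C) Gmx).

Definition Yangian_t (i j : 'I_N) (r : nat) : X :=
  alg_proj (@RTT_relations C s) (free_t C i j r).

Definition Smx : 'M[laurent X]_N :=
  let T := Tmx Yangian_t in
  map_mx (ltrans (- (kappa / 2))%:A) T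
  *m map_mx (lmap (in_alg X)) Gumx
  *m map_mx (lrefl (kappa / 2)%:A) (mxt T).

(* X(g_N, g_p (+) g_q)^tw, generated by the coefficients of u^-(r+1), r >= 0,
   in the series s_ij(u). *)
Definition twYangian : Type :=
  subalg [set x : X | exists i j (r : nat), x = Smx i j (Negz r)].
HB.instance Definition _ := GRing.Lalgebra.on twYangian.

(* mu i is the series mu_i(u); it matters only for i in I_N^+. *)
Definition in_INplus (i : nat) : bool :=
  (i <= n)%N && ((0 < i)%N || is_BI (sp_type s)).

Definition normalized (mu : nat -> laurent C) : Prop :=
  forall i, in_INplus i ->
    mu i 0 = (gsign s i)%:~R /\ forall m : int, 0 < m -> mu i m = 0.

Definition Verma_relations (mu : nat -> laurent C) : set twYangian :=
  [set x | (exists (i j : 'I_N) (m : int), (i < j)%N /\ sub_val x = Smx i j m)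
        \/ (exists (i : 'I_N) (m : int), 0 <= lab i /\
              sub_val x = Smx i i m - (mu (absz (lab i)) m)%:A)].

Definition Verma (mu : nat -> laurent C) : Type :=
  @quot_mod twYangian (twYangian^o) (Verma_relations mu).
HB.instance Definition _ mu := GRing.Lmodule.on (Verma mu).

Definition tmu (mu : nat -> laurent C) (i : nat) : laurent C :=
  (2 * u - n%:R + i%:R) * mu i + \sum_(i.+1 <= j < n.+1) mu j.

Definition gfun (w : laurent C) : laurent C :=
  (if is_BIb (sp_type s) then -1 else 1)
  * ((p%:R + q%:R - 4 * w) / (p%:R - q%:R - 4 * w)).

Record associated (mu : nat -> laurent C) (alpha : C) (P : nat -> {poly C}) :
    Prop := Associated {
  assoc_monic : forall i, (1 <= i <= n)%N -> P i \is monic;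
  assoc_sym1 : P 1%N = P 1%N \Po ((kappa + 2 ^+ delta)%:P - 'X);
  assoc_sym : forall i, (2 <= i <= n)%N ->
    P i = P i \Po ((n - i + 2)%:R%:P - 'X);
  assoc_alpha : (P k.+1).[alpha] != 0;
  assoc_step : forall i, (2 <= i <= n)%N ->
    tmu mu i.-1 / tmu mu i
    = peval (P i) (u + 1) / peval (P i) u
      * ((lconst alpha - u) / (lconst alpha + u - l%:R)) ^+ (i == k.+1);
  assoc_odd : is_BI (sp_type s) ->
    tmu mu 0 / tmu mu 1
    = peval (P 1%N) (u + 1 / 2) / peval (P 1%N) u
      * ((lconst alpha - u) / (lconst alpha + u - n%:R)) ^+ (k == 0%N)
    /\ u * gfun u * lrefl kappa (tmu mu 0)
       = (lconst kappa - u) * gfun (lconst kappa - u) * tmu mu 0;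
  assoc_even : ~~ is_BI (sp_type s) ->
    lrefl kappa (tmu mu 1) / tmu mu (2 ^ (1 - delta))
    = gfun (lconst kappa - u) / gfun u
      * (peval (P 1%N) (u + 2 ^+ delta) / peval (P 1%N) u)
      * ((lconst kappa - u) / u)
}.

Definition deg (P : {poly C}) : nat := (size P).-1.

Definition Adeg (P : nat -> {poly C}) : rat :=
  match sp_type s with
  | CII => (deg (P 1%N))%:R
  | DIa => ((deg (P 1%N))%:R - (deg (P 2%N))%:R) / 2
  | _ => (deg (P 1%N))%:R / 2
  end.

End TwistedYangian.

Definition irreducible (R : pzRingType) (V : lmodType R) : Prop :=
  (exists v : V, v != 0) /\
  forall W : {pred V}, submod_closed W ->
    (forall v, v \in W -> v = 0) \/ (forall v, v \in W).

Definition irr_quotient (R : pzRingType) (M V : lmodType R) : Prop :=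
  irreducible V /\
  exists f : {linear M -> V}, forall v, exists m, f m = v.

(* Finite dimension over C of a module over the C-algebra A. *)
Definition fin_dim (C : comNzRingType) (A : lalgType C) (V : lmodType A) : Prop :=
  exists (m : nat) (e : 'I_m -> V),
    forall v, exists c : 'I_m -> C, v = \sum_i (c i)%:A *: e i.

(* Main.v *)
Require Import Defs.
From mathcomp Require Import all_boot all_order all_algebra.
From mathcomp Require Import boolp classical_sets fsbigop.
From mathcomp Require Import ssrAC mxtens ring lra zify.
From mathcomp.multinomials Require Import monalg.
From mathcomp Require Import reals complex.

Set Implicit Arguments.
Unset Strict Implicit.
Unset Printing Implicit Defensive.

Import Order.TTheory GRing.Theory Num.Theory.

Local Open Scope ring_scope.

(** The coefficients [x_ab = t_ab^(1)] satisfy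
    [[x_ab, x_cd] = delta_bc x_ad - delta_ad x_cb
       - theta_ab (delta_{c,-a} x_{-b,d} - delta_{d,-b} x_{c,-a})],
    and, when [g_aa = g_bb = g], [s_ab^(1)] is [g y_ab] up to a scalar, where
    [y_ab = x_ab - theta_ab x_{-b,-a}].  Put [i = k+1] and [j = k+2].  In the
    symplectic case [y_{-i,i}], [y_{i,-i}], [-y_ii/2], and in the orthogonal case
    [y_{-j,i}], [y_{i,-j}], [-(y_ii + y_jj)/2], span a copy of sl_2 up to scaling
    whose raising operator kills the highest weight vector.  Hence finite
    dimensionality makes the weight of that vector a natural number [m].  This
    weight only involves the subleading coefficients of [mu_{k+1}] and [mu_{k+2}];
    comparing the two leading coefficients in the relations defining an associated
    tuple expresses them through [alpha] and the degrees of the [P_i], so that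
    [2 (alpha - N/4) = A + sum_{a=2}^{k+1} deg P_a + deg P_{k+2} / 2 - m]
    in the orthogonal case and
    [alpha - N/4 = (deg P_1 + sum_{a=2}^{k+1} deg P_a) / 2 - m]
    in the symplectic case.  All the [deg P_i] are even because of the symmetry
    [P_i(u) = P_i(c - u)] of a monic polynomial. *)

(** * Two leading coefficients of a Laurent series *)

(* [f = x u^a + y u^(a-1) + lower terms]. *)
Definition lead2 (A : nzRingType) (f : laurent A) (a : int) (x y : A) : Prop :=
  [/\ forall k, a < k -> f k = 0, f a = x & f (a - 1) = y].

Section Lead2.
Variable A : nzRingType.
Implicit Types f g : laurent A.

Lemma lead2_uniq f a x y x' y' :
  lead2 f a x y -> lead2 f a x' y' -> x = x' /\ y = y'.
Proof. by case=> _ <- <- [_ <- <-]. Qed.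

Lemma lead2D f g a x y x' y' :
  lead2 f a x y -> lead2 g a x' y' -> lead2 (f + g) a (x + x') (y + y').
Proof.
case=> f0 <- <- [g0 <- <-]; split=> // k ak.
by rewrite /= f0 // g0 // addr0.
Qed.

Lemma lead2N f a x y : lead2 f a x y -> lead2 (- f) a (- x) (- y).
Proof. by case=> f0 <- <-; split=> // k ak; rewrite /= f0 // oppr0. Qed.

Lemma lead2B f g a x y x' y' :
  lead2 f a x y -> lead2 g a x' y' -> lead2 (f - g) a (x - x') (y - y').
Proof. by move=> hf hg; apply/lead2D/lead2N. Qed.

Lemma lead2M f g a b x y x' y' :
  lead2 f a x y -> lead2 g b x' y' ->
  lead2 (f * g) (a + b) (x * x') (x * y' + y * x').
Proof.
case=> f0 <- <- [g0 <- <-]; split.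
- exact: lmulc_out.
- have /= := lmulcE f0 g0 0; rewrite subr0 => ->.
  by rewrite /convol big_ord1 /= !subr0.
- have /= := lmulcE f0 g0 1%N => ->.
  by rewrite /convol big_ord_recl big_ord1 /= !subr0.
Qed.

(** The degree may be overestimated by one; this aligns series of different degrees before they are
    added. *)
Lemma lead2_up f a x y : lead2 f a x y -> lead2 f (a + 1) 0 x.
Proof.
by case=> f0 <- _; split=> [k ak||]; rewrite ?addrK // f0 //; lia.
Qed.

Lemma lead2_const (x : A) : lead2 (lconst x) 0 x 0.
Proof. by split=> //= k; case: eqP => // -> //. Qed.

Lemma lead2_var : lead2 (@lvar A) 1 1 0.
Proof. by split=> //= k; case: eqP => // ->. Qed.

Lemma lead2_0 a : lead2 (0 : laurent A) a 0 0.
Proof. by split. Qed.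

Lemma lead2_1 : lead2 (1 : laurent A) 0 1 0.
Proof. exact: lead2_const. Qed.

Lemma lead2_sum (I : Type) (r : seq I) (Q : pred I) (F : I -> laurent A) a x y :
  (forall i, Q i -> lead2 (F i) a (x i) (y i)) ->
  lead2 (\sum_(i <- r | Q i) F i) a (\sum_(i <- r | Q i) x i)
    (\sum_(i <- r | Q i) y i).
Proof.
move=> H; elim: r => [|i r IH]; first by rewrite !big_nil; exact: lead2_0.
by rewrite !big_cons; case: ifP => // Qi; apply: lead2D => //; exact: H.
Qed.

(** Only the terms [j = 0] and [j = 1] of the binomial expansion reach these two coefficients, and
    [binz a 1] is [a] for either sign of [a]. *)
Lemma lead2_ltrans (c : A) f a x y : lead2 f a x y ->
  lead2 (ltrans c f) a x (y + x * (c *~ binz a 1)).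
Proof.
case=> f0 <- <-; split=> [k ak||] /=.
- by apply: fsbig1 => j _; rewrite f0 ?mul0r //; lia.
- rewrite /ltransc -(@fsbig_widen _ _ _ _ [set 0%N]%classic) //; last first.
    by move=> j [_ /= j0]; rewrite f0 ?mul0r //; lia.
  rewrite fsbig_set1 addr0 expr0; case: a {f0} => k /=;
  by rewrite ?bin0 ?addn0 ?binn ?expr0 ?mul1r ?mulr1.
- rewrite /ltransc -(@fsbig_widen _ _ _ _ [set` [:: 0%N; 1%N]]%classic) //; last first.
    by move=> j [_ /=]; rewrite !inE => j0; rewrite f0 ?mul0r //; lia.
  rewrite -fsbig_seq // big_cons big_seq1 addr0 subrK expr0 expr1.
  congr (_ + _); case: (a - 1) => k /=;
  by rewrite ?bin0 ?addn0 ?binn ?expr0 ?mul1r ?mulr1.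
Qed.

Lemma lead2_lrefl (c : A) f x y : lead2 f 1 x y ->
  lead2 (lrefl c f) 1 (- x) (y + x * c).
Proof.
case/(lead2_ltrans c) => f0 f1 f2; split=> [k ak||].
- by have /= -> := f0 k ak; rewrite mulr0.
- by have /= -> := f1; rewrite expr1 mulN1r.
- by have /= -> := f2; rewrite expr0 mul1r binn.
Qed.

Lemma lead2_lrefl0 (c : A) f x y : lead2 f 0 x y ->
  lead2 (lrefl c f) 0 x (- y).
Proof.
case/(lead2_ltrans c) => f0 f1 f2; split=> [k ak||].
- by have /= -> := f0 k ak; rewrite mulr0.
- by have /= -> := f1; rewrite expr0 mul1r.
- by have /= -> := f2; rewrite expr1 mulN1r bin0n mulr0z mulr0 addr0.
Qed.

Lemma lead2_map (B : nzRingType) (phi : {additive A -> B}) f a x y :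
  lead2 f a x y -> lead2 (lmap phi f) a (phi x) (phi y).
Proof. by case=> f0 <- <-; split=> // k ak; rewrite /= f0 // raddf0. Qed.

End Lead2.

Section Lead2Field.
Variable K : fieldType.
Implicit Types f g : laurent K.

Lemma lead2_neq0 f a x y : lead2 f a x y -> x != 0 -> f != 0.
Proof.
by case=> _ fa _; apply: contraNneq => f0; rewrite -fa f0.
Qed.

Lemma lead2V f a x y : lead2 f a x y -> x != 0 ->
  lead2 f^-1 (- a) x^-1 (- (y / x ^+ 2)).
Proof.
move=> hf x0; have f0 := lead2_neq0 hf x0.
have [b [fb0 fb]] := laurent_deg (invr_neq0 f0).
have hV : lead2 f^-1 b (f^-1 b) (f^-1 (b - 1)) by split.
have := lead2M hf hV; rewrite divff // => h.
(* The product of the two leading coefficients is nonzero and is the coefficient of [u^(a+b)] in 1,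
   which forces [a + b = 0]. *)
have ab : b = - a.
  have [_ e1 _] := h; case: (lead2_1 K) => z1 z2 _.
  have : (1 : laurent K) (a + b) != 0 by rewrite e1 mulf_neq0.
  case: (eqVneq (a + b) 0) => [|ab0]; first by lia.
  by rewrite /= (negPf ab0) mulr0n eqxx.
move: h; rewrite ab subrr => /lead2_uniq /(_ (lead2_1 K)) [e1 e2].
have E1 : f^-1 (- a) = x^-1 by apply: (mulfI x0); rewrite e1 divff.
split=> // [k|]; first by rewrite -ab => /fb.
move: e2; rewrite E1 => /(congr1 (fun z => z / x)).
move=> e2.
have : f^-1 (- a - 1) = - (y / x ^+ 2) + (x * f^-1 (- a - 1) + y / x) / x by field.
by rewrite e2 mul0r addr0.
Qed.

Lemma lead2_div f g a b x y x' y' : lead2 f a x y -> lead2 g b x' y' ->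
  x' != 0 -> lead2 (f / g) (a - b) (x / x') ((y - x / x' * y') / x').
Proof.
move=> hf hg x0; have := lead2M hf (lead2V hg x0).
by congr lead2; field.
Qed.

(** Induction along Horner's scheme [p = q X + a]. Since [d] only bounds the degree, the exact
    degree of [q] need not be tracked. *)
Lemma lead2_peval (p : {poly K}) (c : K) d : (size p <= d.+1)%N ->
  lead2 (peval p (lvar + lconst c)) d%:Z p`_d
    ((if d is d'.+1 then p`_d' else 0) + d%:R * c * p`_d).
Proof.
have hw : lead2 (lvar + lconst c) 1 1 c.
  have := lead2D (lead2_var K) (lead2_up (lead2_const c)).
  by rewrite addr0 add0r.
have pE (q : {poly K}) (a : K) : peval (q * 'X + a%:P) (lvar + lconst c) =
    peval q (lvar + lconst c) * (lvar + lconst c) + lconst a.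
  rewrite /peval (rmorphD (map_poly (@lconst K))).
  by rewrite (rmorphM (map_poly (@lconst K))) /= map_polyX map_polyC /= hornerMXaddC.
elim: d p => [|d IH] p.
  move=> /size1_polyC ->; rewrite coefC /= mul0r mul0r addr0.
  by have := lead2_const p`_0; rewrite /peval map_polyC hornerC.
have [q [a ->]] : exists q a, p = q * 'X + a%:P.
  elim/poly_ind: p => [|q a _]; last by exists q, a.
  by exists 0, 0; rewrite mul0r add0r.
rewrite size_MXaddC => szq.
have {}szq : (size q <= d.+1)%N by case: eqP szq => [->|]; rewrite ?size_poly0.
rewrite pE !coefD !coefMX !coefC /= addr0.
have hq := lead2M (IH _ szq) hw.
have ha : lead2 (lconst a) (d%:Z + 1) 0 (if d is 0 then a else 0).
  case: (d) => [|d']; first by apply: (@lead2_up _ _ 0 _ 0); exact: lead2_const.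
  split=> //= [k dk|]; [by case: eqP dk => // ->|].
  by rewrite addrK.
have -> : d.+1%:Z = d%:Z + 1 by lia.
have := lead2D hq ha; congr lead2; first by rewrite mulr1 addr0.
case: (d) => [|d'] /=; rewrite ?addr0 ?add0r -?natr1; ring.
Qed.

End Lead2Field.

(** * Highest weights of sl_2 *)

Section Sl2.
Variables (C : numFieldType) (A : lalgType C) (V : lmodType A).
Variables (e f h : A) (c : C) (v : V).
Hypothesis scalar_central : forall (a : C) (x : A), x * a%:A = a *: x.
Hypothesis ef : e * f = f * e + h.
Hypothesis hf : h * f = f * h - 2 *: f.
Hypothesis ev : e *: v = 0.
Hypothesis hv : h *: v = c%:A *: v.

(** In an [lalgType] scalars pass through a left factor; [scalar_central] lets them cross [x] as
    well. *)
Lemma scalar_actC (a : C) (x : A) (w : V) : x *: (a%:A *: w) = a%:A *: (x *: w).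
Proof. by rewrite !scalerA scalar_central -scalerAl mul1r. Qed.

Lemma scale_act (a : C) (x : A) (w : V) : (a *: x) *: w = a%:A *: (x *: w).
Proof. by rewrite scalerA -scalerAl mul1r. Qed.

Lemma scale_scale (a b : C) (w : V) : a%:A *: (b%:A *: w) = (a * b)%:A *: w.
Proof. by rewrite scalerA -scalerAl mul1r scalerA. Qed.

Lemma sl2_h_string n :
  h *: (f ^+ n *: v) = (c - n.*2%:R)%:A *: (f ^+ n *: v).
Proof.
elim: n => [|n IH]; first by rewrite !expr0 !scale1r subr0.
rewrite exprS -scalerA scalerA hf scalerBl -scalerA IH scalar_actC (scale_act _ f).
rewrite -!scalerBl doubleS -[n.*2.+2]addn2 natrD; congr (_%:A *: _).
by ring.
Qed.

(** Moving [e] past one more [f] adds the weight of [f^(n+1) v], and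
    [(n+1)(c-n) + c - 2(n+1) = (n+2)(c-n-1)]. *)
Lemma sl2_e_string n :
  e *: (f ^+ n.+1 *: v) = (n.+1%:R * (c - n%:R))%:A *: (f ^+ n *: v).
Proof.
elim: n => [|n IH].
  by rewrite expr1 scalerA ef scalerDl -scalerA ev scaler0 add0r hv mul1r subr0
    expr0 scale1r.
rewrite [f ^+ n.+2]exprS -(scalerA f) (scalerA e) ef scalerDl -(scalerA f) IH.
rewrite sl2_h_string scalar_actC (scalerA f) -exprS -!scalerDl.
congr (_%:A *: _).
by rewrite -muln2 natrM -[n.+2%:R]natr1 -[n.+1%:R]natr1; ring.
Qed.

Lemma sl2_e_pow n (a : C) :
  e ^+ n *: (a%:A *: (f ^+ n *: v)) =
  (a * \prod_(i < n) (i.+1%:R * (c - i%:R)))%:A *: v.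
Proof.
elim: n a => [|n IH] a; first by rewrite !expr0 !scale1r big_ord0 mulr1.
rewrite exprSr -scalerA scalar_actC sl2_e_string scale_scale.
rewrite IH big_ord_recr; congr (_%:A *: _); set q := \prod_(_ < _) _.
by rewrite -mulrA [_ * q]mulrC.
Qed.

Lemma sl2_e_pow0 n m (a : C) : (m < n)%N ->
  e ^+ n *: (a%:A *: (f ^+ m *: v)) = 0.
Proof.
move=> mn; rewrite -(subnK mn) addnS -addSn exprD -scalerA sl2_e_pow.
rewrite exprSr -scalerA scalar_actC ev.
by rewrite !scaler0.
Qed.

(** If [c] is not a natural number, no factor [(i+1)(c-i)] vanishes, so [e^n] brings [f^n v] back to
    a nonzero multiple of [v]. All the [f^n v] are then independent, against finite dimension. *)
Lemma sl2_weight_nat : v != 0 -> fin_dim V -> exists n : nat, c = n%:R.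
Proof.
move=> v0 [m [b spanV]]; apply: contrapT => cN.
pose w (n : 'I_m.+1) := f ^+ n *: v.
have [M Mw] : exists M : 'M[C]_(m.+1, m), forall n, w n = \sum_i (M n i)%:A *: b i.
  have [F Fw] := choice (fun n => spanV (w n)).
  by exists (\matrix_(n, i) F n i) => n; rewrite Fw; apply: eq_bigr => i _; rewrite mxE.
(* [M] has more rows than columns, so some nonzero [r] gives a linear relation among
   [v, f v, ..., f^m v]. *)
have /rowV0Pn[r /sub_kermxP rM r0] : kermx M != 0.
  rewrite kermx_eq0 /row_free; apply/negP => /eqP rk.
  by have := rank_leq_col M; rewrite rk ltnn.
have relw : \sum_n (r 0 n)%:A *: w n = 0.
  under eq_bigr => n _ do rewrite Mw scaler_sumr.
  rewrite exchange_big big1 //= => i _.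
  under eq_bigr => n _ do rewrite scalerA -scalerAl mul1r scalerA.
  rewrite -scaler_suml -scaler_suml.
  have := congr1 (fun N : 'rV_m => N 0 i) rM; rewrite !mxE => ->.
  by rewrite !scale0r.
have [n0 rn0] : exists n, r 0 n != 0.
  by apply/existsP; apply: contraNT r0 => /existsPn H; apply/eqP/rowP => n;
    rewrite mxE; apply/eqP; have := H n; rewrite negbK.
(* [e ^+ n], for [n] the last index in the relation, isolates its last term. *)
pose n := [arg max_(n > n0 | r 0 n != 0) (n : nat)].
have [rn nmax] : r 0 n != 0 /\ forall j : 'I_m.+1, (n < j)%N -> r 0 j = 0.
  rewrite /n; case: arg_maxnP => // j rj jmax; split=> // j' jj'.
  by apply/eqP; apply: contraLR jj' => /jmax; rewrite -leqNgt.
have := congr1 (fun x => e ^+ n *: x) relw; rewrite scaler0 scaler_sumr.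
rewrite (bigD1 n) //= big1 ?addr0; last first.
  move=> j jn; have [nj|jn'|/val_inj jn'] := ltngtP n j.
  - by rewrite nmax // !scale0r scaler0.
  - by rewrite sl2_e_pow0.
  - by rewrite jn' eqxx in jn.
rewrite sl2_e_pow; set a := (X in X%:A) => av.
have a0 : a != 0.
  rewrite mulf_neq0 //; apply/prodf_neq0 => i _.
  rewrite mulf_neq0 ?pnatr_eq0 // subr_eq0; apply/eqP => ci.
  by apply: cN; exists i.
case/eqP: v0; have := congr1 (fun x => a^-1%:A *: x) av.
by rewrite scaler0 scale_scale mulVf // !scale1r.
Qed.

End Sl2.

(** * Level-one relations of the extended Yangian *)

Definition lead2mx (A : nzRingType) m n (M : 'M[laurent A]_(m, n)) (X Y : 'M[A]_(m, n)) :=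
  forall i j, lead2 (M i j) 0 (X i j) (Y i j).

Section Lead2Mx.
Variable A : nzRingType.

Lemma lead2mxM m n p (M : 'M[laurent A]_(m, n)) (M' : 'M[laurent A]_(n, p)) X Y X' Y' :
  lead2mx M X Y -> lead2mx M' X' Y' ->
  lead2mx (M *m M') (X *m X') (X *m Y' + Y *m X').
Proof.
move=> hM hM' i j; rewrite !mxE -big_split /=.
by apply: lead2_sum => k _; have := lead2M (hM i k) (hM' k j).
Qed.

Lemma lead2mxD m n (M M' : 'M[laurent A]_(m, n)) X Y X' Y' :
  lead2mx M X Y -> lead2mx M' X' Y' -> lead2mx (M + M') (X + X') (Y + Y').
Proof. by move=> hM hM' i j; rewrite !mxE; exact: lead2D (hM i j) (hM' i j). Qed.

Lemma lead2mxB m n (M M' : 'M[laurent A]_(m, n)) X Y X' Y' :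
  lead2mx M X Y -> lead2mx M' X' Y' -> lead2mx (M - M') (X - X') (Y - Y').
Proof. by move=> hM hM' i j; rewrite !mxE; exact: lead2B (hM i j) (hM' i j). Qed.

Lemma lead2mx_const m n (X : 'M[A]_(m, n)) : lead2mx (map_mx (@lconst A) X) X 0.
Proof. by move=> i j; rewrite !mxE; apply: lead2_const. Qed.

Lemma lead2mx_1 n : lead2mx (1%:M : 'M[laurent A]_n) 1%:M 0.
Proof.
by move=> i j; rewrite !mxE; case: (i == j); [apply: lead2_1 | apply: lead2_0].
Qed.

Lemma sum_mxtens m n (F : 'I_(m * n) -> A) :
  \sum_k F k = \sum_i \sum_j F (mxtens_index (i, j)).
Proof.
rewrite pair_big (reindex (@mxtens_index m n)) /=; last first.
  by exists (@mxtens_unindex m n) => k _; rewrite ?mxtens_indexK ?mxtens_unindexK.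
by apply: eq_bigr => -[].
Qed.

End Lead2Mx.

Section RTT.
Variables (C : fieldType) (s : sym_pair).
Notation N := (sp_N s).

Lemma PmxE (A : nzRingType) (a b c d : 'I_N) :
  Pmx s A (mxtens_index (a, c)) (mxtens_index (b, d)) = ((a == d) && (c == b))%:R.
Proof.
rewrite /Pmx summxE (bigD1 a) //= [X in _ + X]big1 ?addr0; last first.
  move=> i ia; rewrite summxE big1 // => j _.
  by rewrite tensmxE !mxE eq_sym (negPf ia) mul0r.
rewrite summxE (bigD1 b) //= [X in _ + X]big1 ?addr0; last first.
  by move=> j jb; rewrite tensmxE !mxE [b == j]eq_sym (negPf jb) andbF mul0r.
by rewrite tensmxE !mxE !eqxx mul1r andbC [d == a]eq_sym.
Qed.

Lemma QmxE (A : nzRingType) (a b c d : 'I_N) :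
  Qmx s A (mxtens_index (a, c)) (mxtens_index (b, d)) =
  (theta (rev_ord b) (rev_ord a))%:~R * ((c == rev_ord a) && (d == rev_ord b))%:R.
Proof.
rewrite /Qmx summxE (bigD1 (rev_ord b)) //= [X in _ + X]big1 ?addr0; last first.
  move=> i ib; rewrite summxE big1 // => j _.
  by rewrite tensmxE !mxE [rev_ord b == i]eq_sym (negPf ib) mulr0 mul0r.
rewrite summxE (bigD1 (rev_ord a)) //= [X in _ + X]big1 ?addr0; last first.
  move=> j ja; rewrite tensmxE !mxE [rev_ord a == j]eq_sym (negPf ja) andbF.
  by rewrite mulr0 mul0r.
by rewrite tensmxE !mxE !eqxx mulr1.
Qed.

Lemma map_Pmx (A B : nzRingType) (phi : {rmorphism A -> B}) :
  map_mx phi (Pmx s A) = Pmx s B.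
Proof.
apply/matrixP => i j; case: (mxtens_indexP i) => a c; case: (mxtens_indexP j) => b d.
by rewrite mxE !PmxE rmorph_nat.
Qed.

Lemma map_Qmx (A B : nzRingType) (phi : {rmorphism A -> B}) :
  map_mx phi (Qmx s A) = Qmx s B.
Proof.
apply/matrixP => i j; case: (mxtens_indexP i) => a c; case: (mxtens_indexP j) => b d.
by rewrite mxE !QmxE rmorphM rmorph_int rmorph_nat.
Qed.

Lemma lead2_inv_var (K : fieldType) (c : K) :
  exists z, lead2 (lvar - lconst c)^-1 (- 1) 1 z.
Proof.
have h := lead2D (lead2_var K) (lead2_up (lead2N (lead2_const c))).
have := lead2V h; rewrite addr0 invr1 => H.
by exists (- ((0 - c) / 1 ^+ 2)); apply: H; rewrite oner_eq0.
Qed.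

(** Both fractions start with [u^-1]; [v] and [kappa] enter them only from [u^-2] on. *)
Lemma lead2_Rmx : lead2mx (Rmx C s) 1%:M (Qmx s _ - Pmx s _).
Proof.
have low (K : nzRingType) (f : laurent K) (x z : K) :
    lead2 f (- 1) x z -> lead2 f 0 0 x.
  by move=> h; have := lead2_up h.
have {}low (K : fieldType) (f : laurent K) z (X : 'M[K]_(N * N))
    (Y : 'M[laurent K]_(N * N)) :
    map_mx (@lconst K) X = Y -> lead2 f (- 1) 1 z -> lead2mx (f *: Y) 0 X.
  move=> <- /low h i j; rewrite !mxE.
  by have := lead2M h (lead2_const (X i j)); rewrite mul0r mulr0 mul1r !add0r.
have [z1 h1] := lead2_inv_var (@lvar C).
have [z2] := lead2_inv_var (@lvar C + lconst (kappa C s)).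
rewrite rmorphD opprD addrA => h2.
have := lead2mxD (lead2mxB (@lead2mx_1 _ _)
  (low _ _ _ _ _ (map_Pmx (@lconst _)) h1)) (low _ _ _ _ _ (map_Qmx (@lconst _)) h2).
by rewrite subr0 addr0 sub0r [Qmx _ _ - _]addrC.
Qed.

Definition tcoef1 (A : nzRingType) (t : 'I_N -> 'I_N -> nat -> A) : 'M[A]_N :=
  \matrix_(i, j) t i j 0%N.

Lemma lead2_Tmx (A : nzRingType) (t : 'I_N -> 'I_N -> nat -> A) :
  lead2mx (Tmx t) 1%:M (tcoef1 t).
Proof. by move=> i j; rewrite !mxE; split=> //= -[[|k]|k]. Qed.

Lemma tens1mx1 (A : nzRingType) : (1%:M *t 1%:M : 'M[A]_(N * N)) = 1%:M.
Proof.
apply/matrixP => i j; case: (mxtens_indexP i) => a c; case: (mxtens_indexP j) => b d.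
rewrite tensmxE !mxE (can_eq (@mxtens_indexK _ _)) xpair_eqE.
by case: (a == b); rewrite ?mul1r ?mul0r.
Qed.

Lemma lead2_mxtensl (A : nzRingType) (M : 'M[laurent A]_N) X Y :
  lead2mx M X Y -> lead2mx (M *t 1%:M : 'M_(N * N)) (X *t 1%:M) (Y *t 1%:M).
Proof.
move=> hM i j; case: (mxtens_indexP i) => a c; case: (mxtens_indexP j) => b d.
rewrite !tensmxE; have := lead2M (hM a b) (@lead2mx_1 A N c d).
by rewrite [(0 : 'M_N) _ _]mxE mulr0 !add0r.
Qed.

Lemma lead2_mxtensr (A : nzRingType) (M : 'M[laurent A]_N) X Y :
  lead2mx M X Y -> lead2mx (1%:M *t M : 'M_(N * N)) (1%:M *t X) (1%:M *t Y).
Proof.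
move=> hM i j; case: (mxtens_indexP i) => a c; case: (mxtens_indexP j) => b d.
rewrite !tensmxE; have := lead2M (@lead2mx_1 A N a b) (hM c d).
by rewrite [(0 : 'M_N) _ _]mxE mul0r !addr0.
Qed.

(** The coefficient of [u^-1 v^-1] in the defining relation, extracted first in [u] (the outer
    series) and then in [v]. *)
Lemma RTT_coef11 (A : lalgType C) (t : 'I_N -> 'I_N -> nat -> A) i j :
  let X1 := tcoef1 t *t 1%:M in let X2 := 1%:M *t tcoef1 t in
  let K := Qmx s A - Pmx s A in
  RTT t i j (- 1) (- 1) = ((X1 + K) *m X2 - X2 *m (K + X1)) i j.
Proof.
move=> X1 X2 K.
set R := map_mx (lmap (lmap (in_alg A))) (Rmx C s).
have hR : lead2mx R 1%:M (map_mx (@lconst A) K).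
  move=> a b; have := lead2_map (lmap (in_alg A)) (lead2_Rmx a b).
  rewrite !mxE; congr lead2.
    exact: (rmorph_nat (lmap (in_alg A) : {rmorphism _ -> _})).
  pose phi : {rmorphism _ -> _} := lmap (in_alg A).
  have := congr1 (fun M : 'M_(N * N) => M a b) (map_Qmx phi).
  have := congr1 (fun M : 'M_(N * N) => M a b) (map_Pmx phi).
  have := congr1 (fun M : 'M_(N * N) => M a b) (map_Qmx (@lconst A)).
  have := congr1 (fun M : 'M_(N * N) => M a b) (map_Pmx (@lconst A)).
  by rewrite !mxE !raddfB /= => -> -> -> ->.
have hT1 : lead2mx (map_mx (lmap (@lconst A)) (Tmx t) *t 1%:M : 'M_(N * N))
    1%:M (map_mx (@lconst A) X1).
  have h : lead2mx (map_mx (lmap (@lconst A)) (Tmx t)) 1%:M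
      (map_mx (@lconst A) (tcoef1 t)).
    move=> a b; have := lead2_map (@lconst A) (lead2_Tmx t a b).
    rewrite !mxE; congr lead2.
    exact: (rmorph_nat (@lconst A : {rmorphism _ -> _})).
  by rewrite -tens1mx1 map_mxT map_mx1; apply: lead2_mxtensl.
(* [T_2(v)] is constant in [u], so the whole series in [v] is its leading coefficient and the next
   one is 0. *)
pose T2 : 'M_(N * N) := (1%:M : 'M_N) *t Tmx t.
have hT2 : lead2mx (1%:M *t map_mx (@lconst (laurent A)) (Tmx t)) T2 0.
  by rewrite -(map_mx1 (@lconst (laurent A))) -map_mxT; apply: lead2mx_const.
have [_ _ h] := lead2mxB (lead2mxM (lead2mxM hR hT1) hT2)
   (lead2mxM (lead2mxM hT2 hT1) hR) i j.
rewrite /RTT -/R h.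
rewrite !mul1mx !mulmx1 add0r addr0 -mulmxDr.
(* Second extraction, in [v]: now [X1] and [K] are the constants. *)
have cX := lead2mx_const X1; have cK := lead2mx_const K.
have hT := lead2_mxtensr (lead2_Tmx t).
have [_ _ ->] := lead2mxB (lead2mxM (lead2mxD cX cK) hT)
  (lead2mxM hT (lead2mxD cK cX)) i j.
by rewrite !addr0 mul0mx mulmx0 addr0 add0r.
Qed.

End RTT.

(** * Entries of products with [P], [Q] and one-sided tensors *)

Section TensEntries.
Variables (A : nzRingType) (s : sym_pair).
Notation N := (sp_N s).
Variables (X Y : 'M[A]_N) (a b c d : 'I_N).
Notation ac := (mxtens_index (a, c)).
Notation bd := (mxtens_index (b, d)).

Lemma mul_mx_1tensE (M : 'M[A]_(N * N)) :
  (M *m (1%:M *t X)) ac bd = \sum_g M ac (mxtens_index (b, g)) * X g d.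
Proof.
rewrite mxE sum_mxtens (bigD1 b) //= [X in _ + X]big1 ?addr0.
  by apply: eq_bigr => g _; rewrite tensmxE mxE eqxx mul1r.
move=> e eb; rewrite big1 // => g _.
by rewrite tensmxE mxE (negPf eb) mul0r mulr0.
Qed.

Lemma mul_1tens_mxE (M : 'M[A]_(N * N)) :
  ((1%:M *t X) *m M) ac bd = \sum_g X c g * M (mxtens_index (a, g)) bd.
Proof.
rewrite mxE sum_mxtens (bigD1 a) //= [X in _ + X]big1 ?addr0.
  by apply: eq_bigr => g _; rewrite tensmxE mxE eqxx mul1r.
move=> e ea; rewrite big1 // => g _.
by rewrite tensmxE mxE eq_sym (negPf ea) !mul0r.
Qed.

Lemma tens12E : ((Y *t 1%:M) *m (1%:M *t X)) ac bd = Y a b * X c d.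
Proof.
rewrite mul_mx_1tensE (bigD1 c) //= big1 ?addr0 => [|g gc].
  by rewrite tensmxE mxE eqxx mulr1.
by rewrite tensmxE mxE eq_sym (negPf gc) mulr0 mul0r.
Qed.

Lemma tens21E : ((1%:M *t X) *m (Y *t 1%:M)) ac bd = X c d * Y a b.
Proof.
rewrite mul_1tens_mxE (bigD1 d) //= big1 ?addr0 => [|g gd].
  by rewrite tensmxE mxE eqxx mulr1.
by rewrite tensmxE mxE (negPf gd) !mulr0.
Qed.

Lemma Ptens2E : (Pmx s A *m (1%:M *t X)) ac bd = X a d *+ (b == c).
Proof.
rewrite mul_mx_1tensE (bigD1 a) //= big1 ?addr0 => [|g ga].
  by rewrite PmxE eqxx eq_sym mulr_natl.
by rewrite PmxE eq_sym (negPf ga) mul0r.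
Qed.

Lemma tens2PE : ((1%:M *t X) *m Pmx s A) ac bd = X c b *+ (a == d).
Proof.
rewrite mul_1tens_mxE (bigD1 b) //= big1 ?addr0 => [|g gb].
  by rewrite PmxE eqxx andbT mulr_natr.
by rewrite PmxE (negPf gb) andbF mulr0.
Qed.

Lemma Qtens2E : (Qmx s A *m (1%:M *t X)) ac bd =
  X (rev_ord b) d *~ theta (rev_ord b) (rev_ord a) *+ (c == rev_ord a).
Proof.
rewrite mul_mx_1tensE (bigD1 (rev_ord b)) //= big1 ?addr0 => [|g gb].
  by rewrite QmxE eqxx andbT; case: eqP => _; rewrite ?mulr1 ?mulr0 ?mul0r ?mulrzl.
by rewrite QmxE (negPf gb) andbF mulr0 mul0r.
Qed.

Lemma tens2QE : ((1%:M *t X) *m Qmx s A) ac bd =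
  X c (rev_ord a) *~ theta (rev_ord b) (rev_ord a) *+ (d == rev_ord b).
Proof.
rewrite mul_1tens_mxE (bigD1 (rev_ord a)) //= big1 ?addr0 => [|g ga].
  by rewrite QmxE eqxx /= mulrA mulrzr mulr_natr.
by rewrite QmxE (negPf ga) /= !mulr0.
Qed.

End TensEntries.

Lemma malg_scalar_central (K : monomType) (R : comNzRingType) (c : R) (g : {malg R[K]}) :
  g * c%:A = c *: g.
Proof.
rewrite -!mul_malgC mulr1 !malgM_def fgmulgU fgmulUg.
by apply: eq_bigr => k _; rewrite mulrC mulm1 mul1m.
Qed.

Section YangianComm.
Variables (C : fieldType) (s : sym_pair).
Notation N := (sp_N s).

(** The first two correction terms come from [P], the last two from [Q]. *)
Definition level1_rel (A : nzRingType) (x : 'I_N -> 'I_N -> A) := forall a b c d,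
  x a b * x c d = x c d * x a b + x a d *+ (b == c) - x c b *+ (a == d)
   - x (rev_ord b) d *~ theta (rev_ord b) (rev_ord a) *+ (c == rev_ord a)
   + x c (rev_ord a) *~ theta (rev_ord b) (rev_ord a) *+ (d == rev_ord b).

(** The free generators satisfy the relation only after its coefficients are killed, hence the
    morphism [phi], later the projection onto the extended Yangian. *)
Lemma RTT_comm (A : lalgType C) (B : nzRingType) (phi : {rmorphism A -> B})
    (t : 'I_N -> 'I_N -> nat -> A) :
  (forall i j, phi (RTT t i j (- 1) (- 1)) = 0) ->
  level1_rel (fun a b => phi (t a b 0%N)).
Proof.
move=> phi0 a b c d.
have := phi0 (mxtens_index (a, c)) (mxtens_index (b, d)).
rewrite RTT_coef11 !(mulmxDl, mulmxDr).
have E (M1 M2 M3 M4 M5 M6 : 'M[A]_(N * N)) i j :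
    (M1 + (M2 - M3) - (M4 - M5 + M6)) i j =
    M1 i j + (M2 i j - M3 i j) - (M4 i j - M5 i j + M6 i j).
  by rewrite !mxE.
rewrite mulNmx mulmxN E.
rewrite tens12E Qtens2E Ptens2E tens2QE tens2PE tens21E !mxE.
rewrite !(rmorphB, rmorphD, rmorphMn, rmorphMz, rmorphM) /= => H.
apply/eqP; rewrite -subr_eq0 -H !opprD !opprK !addrA; apply/eqP.
by rewrite [RHS](ACl (1*6*3*5*2*4))%AC.
Qed.

Notation X := (Yangian C s).

Lemma Yangian_comm_rel : level1_rel (fun a b => @Yangian_t C s a b 0%N).
Proof.
pose phi : {rmorphism free_alg C s -> X} := alg_proj (@RTT_relations C s).
apply: (RTT_comm (phi := phi)) => i j.
rewrite -(linear0 (alg_proj (@RTT_relations C s))); apply/alg_projP; rewrite subr0.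
by apply/asboolP => I _; apply; exists i, j, (-1), (-1).
Qed.

(** Centrality of scalars descends from the free algebra, since the projection is surjective and
    linear. *)
Lemma Yangian_scalar_central (a : C) (x : X) : x * a%:A = a *: x.
Proof.
pose phi : {linear free_alg C s -> X} := alg_proj (@RTT_relations C s).
pose psi : {rmorphism free_alg C s -> X} := alg_proj (@RTT_relations C s).
have psiZ (b : C) (y : free_alg C s) : psi (b *: y) = b *: psi y.
  exact: (linearZ_LR phi).
have -> : x = psi (repr x) by rewrite /psi /= alg_proj_repr.
have -> : a%:A = psi a%:A by rewrite psiZ rmorph1.
by rewrite -rmorphM malg_scalar_central psiZ.
Qed.

End YangianComm.

(** * Level-one generators of the twisted Yangian *)

Section SmxCoef.
Variables (C : numFieldType) (s : sym_pair).
Notation N := (sp_N s).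

(* This is F_ab when [t a b] is the generator E_ab. *)
Definition antisym (A : nzRingType) (t : 'I_N -> 'I_N -> A) a b : A :=
  t a b - t (rev_ord b) (rev_ord a) *~ theta (rev_ord b) (rev_ord a).

Lemma lab_rev (a : 'I_N) : lab (rev_ord a) = - lab a.
Proof.
rewrite /lab /= subnS; have := ltn_ord a; move: (a : nat) => {}a.
rewrite /sp_N; case: (is_BI _) => /=; [lia | rewrite addn0 => h].
by case: ifP; case: ifP; lia.
Qed.

Lemma theta_diag (a : 'I_N) : theta a a = 1.
Proof.
rewrite /theta; case E: (is_CII _) => //.
rewrite mulz_sg; suff -> : lab a != 0 by [].
rewrite /lab; have -> /= : is_BI (sp_type s) = false by case: (sp_type s) E.
by case: ifP => h; apply/eqP; lia.
Qed.

Notation gs a := (gsign s (lab a)).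
Notation d := (((sp_p s)%:R - (sp_q s)%:R) / 4 : C).

(** This is the expansion of [(G - d u^-1)(1 + d u^-1 + ...)]. *)
Lemma lead2_Gumx : lead2mx (Gumx C s) (Gmx C s) (d *: (Gmx C s - 1%:M)).
Proof.
have h := lead2B (lead2_up (lead2_const d)) (lead2_var C).
have {h} h : lead2 (lconst d - lvar) 1 (- 1) d by move: h; rewrite sub0r subr0.
have {h} h := lead2V h; rewrite oppr_eq0 oner_eq0 in h; have {}h := h isT.
move=> a b; rewrite /Gumx mxE.
have hm : lead2 (((lconst d)%:M - lvar *: map_mx (@lconst C) (Gmx C s)) a b) 1
    (- Gmx C s a b) (d *+ (a == b)).
  rewrite !mxE; have := lead2B (lead2_up (lead2_const (d *+ (a == b))))
    (lead2M (lead2_var C) (lead2_const (Gmx C s a b))).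
  rewrite raddfMn mul1r sub0r mul0r mulr0 !addr0 subr0.
  rewrite /Gmx !mxE add0r; exact: id.
have := lead2M h hm; congr lead2; rewrite !mxE; by field.
Qed.

Section AbstractS.
Variables (A : lalgType C) (t : 'I_N -> 'I_N -> nat -> A).
Notation x a b := (t a b 0%N).

Lemma lead2mx_map (B B' : nzRingType) (phi : {additive B -> B'}) m n
    (M : 'M[laurent B]_(m, n)) X Y :
  lead2mx M X Y -> lead2mx (map_mx (lmap phi) M) (map_mx phi X) (map_mx phi Y).
Proof. by move=> h i j; rewrite !mxE; exact: lead2_map (h i j). Qed.

Lemma lead2_mxtT (c : A) : lead2mx (map_mx (lrefl c) (mxt (Tmx t)))
  1%:M (\matrix_(a, b) - (x (rev_ord b) (rev_ord a) *~ theta (rev_ord b) (rev_ord a))).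
Proof.
move=> a b; rewrite 4!mxE.
set th := theta _ _; have hth : lead2 (th%:~R : laurent A) 0 th%:~R 0.
  by have := lead2_const (th%:~R : A); rewrite rmorph_int.
have := lead2_lrefl0 c (lead2M hth (lead2_Tmx t (rev_ord b) (rev_ord a))).
rewrite !mxE (inj_eq rev_ord_inj) mul0r addr0 !mulrzl [b == a]eq_sym.
have -> : (a == b)%:R *~ th = (a == b)%:R :> A; last by [].
by rewrite /th; case: eqP => [->|_]; rewrite ?mul0rz // theta_diag.
Qed.

(** The shifts [c], [c'] do not reach this coefficient because [T] has a constant leading term. The
    three factors contribute [g_b x_ab], [d (g - 1)] and [- g_a theta_ab x_{-b,-a}]; equal signs
    allow [g] to be factored out. *)
Lemma tw_coef (c c' : A) (a b : 'I_N) : gs a = gs b ->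
  (map_mx (ltrans c) (Tmx t) *m map_mx (lmap (in_alg A)) (Gumx C s)
     *m map_mx (lrefl c') (mxt (Tmx t))) a b (- 1)
  = antisym (fun a b => x a b) a b *~ gs a + (d * ((gs a)%:~R - 1))%:A *+ (a == b).
Proof.
move=> gab.
have hT : lead2mx (map_mx (ltrans c) (Tmx t)) 1%:M (tcoef1 t).
  move=> i j; rewrite mxE; have := lead2_ltrans c (lead2_Tmx t i j).
  by rewrite mulr0z mulr0 addr0.
have hG := lead2mx_map (in_alg A) lead2_Gumx.
have [_ _ ->] := lead2mxM (lead2mxM hT hG) (lead2_mxtT c') a b.
rewrite !mul1mx !mulmx1 map_diag_mx mul_mx_diag mul_diag_mx !mxE.
have -> : d * ((gs a)%:~R *+ (a == b) - (a == b)%:R) = d * ((gs a)%:~R - 1) *+ (a == b).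
  by case: (a == b); rewrite ?subr0 ?mulr0.
rewrite gab; move: (gs b) => g.
have gE : in_alg A g%:~R = g%:~R by exact: rmorph_int.
rewrite [X in X * - _ + _]gE [X in _ + (_ + _ * X)]gE mulrzl mulrzr raddfMn.
rewrite /antisym mulrzBl.
by rewrite mulNrz addrCA addrC [- _ + _]addrC.
Qed.
End AbstractS.

Lemma Smx_coef (a b : 'I_N) : gs a = gs b ->
  Smx C s a b (- 1) = antisym (fun a b => @Yangian_t C s a b 0%N) a b *~ gs a
                     + (d * ((gs a)%:~R - 1))%:A *+ (a == b).
Proof. exact: tw_coef. Qed.

End SmxCoef.

(** * Commutators of the elements [y_ab] and the sl_2 triples *)

Section Brackets.
Variables (s : sym_pair) (A : nzRingType).
Notation N := (sp_N s).
Variable x : 'I_N -> 'I_N -> A.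
Hypothesis x_comm : level1_rel x.
Notation y := (antisym x).
Notation rv := rev_ord.

Definition commr (u v : A) := u * v - v * u.

Lemma commrDl u v w : commr (u + v) w = commr u w + commr v w.
Proof. by rewrite /commr mulrDl mulrDr opprD addrACA. Qed.

Lemma commrBl u v w : commr (u - v) w = commr u w - commr v w.
Proof. by rewrite /commr mulrBl mulrBr !opprB !addrA [RHS](ACl (1*4*3*2))%AC. Qed.

Lemma commrBr u v w : commr w (u - v) = commr w u - commr w v.
Proof. by rewrite /commr mulrBl mulrBr !opprB !addrA [RHS](ACl (1*4*3*2))%AC. Qed.

Lemma commrMzl u w z : commr (u *~ z) w = commr u w *~ z.
Proof. by rewrite /commr mulrzAl mulrzAr mulrzBl. Qed.

Lemma thetaM a b : @theta s a b * theta a b = 1.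
Proof.
rewrite /theta; case E: (is_CII _) => //.
have := theta_diag a; have := theta_diag b; rewrite /theta E => hb ha.
by rewrite mulrACA ha hb.
Qed.

Lemma theta_rev a b : @theta s (rv b) (rv a) = theta a b.
Proof. by rewrite /theta !lab_rev !sgzN mulrNN mulrC. Qed.

Lemma commr_xx a b c d : commr (x a b) (x c d) =
  x a d *+ (b == c) - x c b *+ (a == d)
   - x (rv b) d *~ theta a b *+ (c == rv a)
   + x c (rv a) *~ theta a b *+ (d == rv b).
Proof.
rewrite /commr x_comm theta_rev; set u := _ * _.
by rewrite -!addrA addrC !addrA subrK.
Qed.

(** Replacing [(a, b)] by [(-b, -a)] exchanges the [P] terms with the [Q] terms, so both summands of
    [y_ab] have the same bracket with [x_cd]; hence the factor 2. *)
Lemma commr_yx a b c d : commr (y a b) (x c d) =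
  (x a d *+ (b == c) - x c b *+ (a == d)
   - x (rv b) d *~ theta a b *+ (c == rv a)
   + x c (rv a) *~ theta a b *+ (d == rv b)) *+ 2.
Proof.
rewrite /antisym commrBl commrMzl !commr_xx !theta_rev !rev_ordK mulr2n; congr (_ + _).
rewrite -mulNrz !(mulrzBl, mulrzDl, opprD, opprB, mulNrz, opprK).
rewrite [LHS](ACl (3*4*1*2))%AC [c == b]eq_sym [d == a]eq_sym.
rewrite [rv a == c]eq_sym [rv b == d]eq_sym.
have thK (z : A) (e : bool) : z *~ theta a b *+ e *~ theta a b = z *+ e.
  by case: e; rewrite ?mul0rz // -mulrzA thetaM.
have thC (z : A) (e : bool) : z *+ e *~ theta a b = z *~ theta a b *+ e.
  by case: e; rewrite ?mul0rz.
by rewrite !thK !thC.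
Qed.

(** Two indices are used because [y_{i,-i} = 0] when [theta] is 1. The hypotheses make
    [i, j, -i, -j] distinct, which removes all cross terms. *)
Lemma sl2_orth i j : (forall a b, @theta s a b = 1) ->
  i != j -> i != (rv i) -> j != (rv j) -> i != (rv j) -> 
  commr (y (rv j) i) (y i (rv j)) = - (y i i + y j j) *+ 2 /\
  commr (y i i + y j j) (y i (rv j)) = y i (rv j) *+ 4.
Proof.
move=> th1 ij ii jj ijr.
have ji : (j == i) = false by rewrite eq_sym (negPf ij).
have ijF : (i == j) = false by exact: negPf.
have iiF : (i == (rv i)) = false by exact: negPf.
have iiF' : ((rv i) == i) = false by rewrite eq_sym.
have jjF : (j == (rv j)) = false by exact: negPf.
have jjF' : ((rv j) == j) = false by rewrite eq_sym.
have ijrF : (i == (rv j)) = false by exact: negPf.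
have ijrF' : ((rv j) == i) = false by rewrite eq_sym.
have jirF : (j == (rv i)) = false by rewrite -(inj_eq rev_ord_inj) rev_ordK eq_sym.
have jirF' : ((rv i) == j) = false by rewrite eq_sym.
have yE a b : y a b = x a b - x (rv b) (rv a) by rewrite /antisym th1.
have rr a b : ((rv a) == (rv b)) = (a == b) := inj_eq rev_ord_inj a b.
have yf u : commr u (y i (rv j)) = commr u (x i (rv j)) - commr u (x j (rv i)).
  by rewrite yE rev_ordK commrBr.
rewrite commrDl !yf !commr_yx !th1 !rev_ordK !rr.
rewrite !(ji, ijF, iiF, iiF', jjF, jjF', ijrF, ijrF', jirF, jirF', eqxx).
rewrite !(mulr0n, mulr1n, subr0, addr0, sub0r, add0r).
rewrite !mulr1z !yE !rev_ordK -!mulrnBl -mulrnDr; split; last by [].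
congr (_ *+ 2); rewrite !opprD !opprK !addrA.
by rewrite [RHS](ACl (4*1*2*3))%AC.
Qed.

(** Here [theta_{i,-i} = -1], so [y_{i,-i} = 2 x_{i,-i}] and one index suffices. The constant 8
    combines this 2, the 2 of [commr_yx], and the coincidence of [P] and [Q] terms. *)
Lemma sl2_symp i : (forall a b, @theta s a b = sgz (lab a) * sgz (lab b)) -> 0 < lab i ->
  i != (rv i) -> 
  commr (y (rv i) i) (y i (rv i)) = - y i i *+ 8 /\
  commr (y i i) (y i (rv i)) = y i (rv i) *+ 4.
Proof.
move=> th1 i0 ii.
have iiF : (i == (rv i)) = false by exact: negPf.
have iiF' : ((rv i) == i) = false by rewrite eq_sym.
have thii : theta i i = 1 by rewrite theta_diag.
have thir : theta (rv i) i = -1 by rewrite th1 lab_rev sgzN gtr0_sgz // mulN1r.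
have thri : theta i (rv i) = -1 by rewrite th1 lab_rev sgzN gtr0_sgz // mulrN1.
have yE : y i (rv i) = x i (rv i) *+ 2.
  by rewrite /antisym theta_rev rev_ordK thri mulrN1z opprK mulr2n.
have yE' : y i i = x i i - x (rv i) (rv i) by rewrite /antisym theta_rev thii.
have yf u : commr u (y i (rv i)) = commr u (x i (rv i)) *+ 2.
  by rewrite yE /commr mulrnAl mulrnAr mulrnBl.
rewrite !yf !commr_yx !rev_ordK thii thir yE yE' !eqxx !iiF.
rewrite !(mulr0n, mulr1n, subr0, mulrN1z, mulr1z, opprK, opprB).
split; last by rewrite -mulr2n -!mulrnA.
by rewrite -(addrA (_ - _)) -mulr2n -!mulrnA.
Qed.
End Brackets.

(** As [g^2 = 1], one has [g e (g - 1) = e (1 - g)]. This recovers [y_ii] from the diagonal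
    generator [g y_ii + e (g - 1)]. *)
Lemma scale_sign_shift (C : fieldType) (A : lalgType C) (g : int) (u : A) (e : C) :
  g%:~R * g%:~R = 1 :> C ->
  g%:~R *: (u *~ g + (e * (g%:~R - 1))%:A *+ true) - (e * (1 - g%:~R))%:A = u.
Proof.
move=> gg; rewrite mulr1n scalerDr -scaler_int !scalerA gg scale1r.
rewrite (_ : g%:~R * (e * (g%:~R - 1)) = e * (1 - g%:~R)) ?addrK //.
by rewrite mulrCA mulrBr gg mulr1.
Qed.

(** * Transfer of an sl_2 triple along an injective algebra map *)

Section Sl2Sub.
Variables (C : numFieldType) (T X : lalgType C) (sv : T -> X).
Hypothesis sv_inj : injective sv.
Hypothesis svM : {morph sv : u w / u * w}.
Hypothesis svB : {morph sv : u w / u - w}.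
Hypothesis svZ : forall c, {morph sv : u / c *: u}.
Hypothesis sv1 : sv 1 = 1.
Hypothesis scalar_central : forall (c : C) (u : X), u * c%:A = c *: u.

Lemma central_scalerAr (c : C) (u w : X) : u * (c *: w) = c *: (u * w).
Proof. by rewrite -[c *: w]mulr_algl mulrA scalar_central -scalerAl. Qed.

Lemma commrZl (c : C) (u w : X) : commr (c *: u) w = c *: commr u w.
Proof. by rewrite /commr central_scalerAr -scalerAl scalerBr. Qed.

Variables (I : eqType) (r : seq I) (sab sba : T) (sd : I -> T).
Variables (yab yba : X) (yd : I -> X) (g : int) (e : C) (m : nat).
Hypothesis gg : g%:~R * g%:~R = 1 :> C.
Hypothesis sabE : sv sab = yab *~ g.
Hypothesis sbaE : sv sba = yba *~ g.
Hypothesis sdE : forall i, i \in r -> sv (sd i) = yd i *~ g + (e * (g%:~R - 1))%:A.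
Hypothesis m_gt0 : (0 < m)%N.
Hypothesis ab_comm : commr yab yba = - (\sum_(i <- r) yd i) *+ m.
Hypothesis d_comm : commr (\sum_(i <- r) yd i) yba = yba *+ 4.
Variables (V : lmodType T) (v : V) (c : I -> C).
Hypothesis v_up : sab *: v = 0.
Hypothesis v_diag : forall i, i \in r -> sd i *: v = (c i)%:A *: v.

(** The sl_2 relations are checked in [X] and pulled back by injectivity of [sv]. The list [r] of
    diagonal indices treats the one-index and two-index triples together. *)
Lemma sl2_sub_weight_nat : v != 0 -> fin_dim V -> exists n : nat,
  - (\sum_(i <- r) (g%:~R * c i - e * (1 - g%:~R))) / 2 = n%:R.
Proof.
move=> v0 fdV.
have centralT (a : C) (u : T) : u * a%:A = a *: u.
  by apply: sv_inj; rewrite svM !svZ sv1 scalar_central.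
have gK (u : X) : g%:~R *: (u *~ g) = u.
  by rewrite -scaler_int scalerA gg scale1r.
have sv0 : sv 0 = 0 by have := svB 0 0; rewrite !subrr.
have svD : {morph sv : u w / u + w}.
  by move=> u w; rewrite -{1}[w]opprK svB -[- w]sub0r svB sv0 sub0r opprK.
(* The bracket of [yab] and [yba] is [2 m] times the image of [H], which fixes the factor in [E];
   the multiples of [g] undo the signs. *)
pose E : T := (g%:~R / (2 * m%:R)) *: sab.
pose F : T := g%:~R *: sba.
pose H : T := (- 1 / 2) *: \sum_(i <- r) (g%:~R *: sd i - (e * (1 - g%:~R))%:A).
have EE : sv E = (2 * m%:R)^-1 *: yab.
  by rewrite svZ sabE mulrC -scalerA gK.
have FE : sv F = yba by rewrite svZ sbaE gK.
have HE : sv H = (- 1 / 2) *: \sum_(i <- r) yd i.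
  rewrite svZ (big_morph sv svD sv0); congr (_ *: _).
  rewrite [LHS]big_seq [RHS]big_seq; apply: eq_bigr => i ir.
  by rewrite svB !svZ sv1 sdE // -[X in _ + X *: 1]mulr1n; exact: scale_sign_shift.
have ef : E * F = F * E + H.
  apply: sv_inj; rewrite svD !svM -[LHS](subrK (sv F * sv E)) addrC; congr (_ + _).
  rewrite -[LHS]/(commr _ _) HE EE FE commrZl ab_comm -scaler_nat -scaleN1r !scalerA.
  by congr (_ *: _); field; rewrite pnatr_eq0 -lt0n.
have hf : H * F = F * H - 2 *: F.
  apply: sv_inj; rewrite svB svZ !svM -[LHS](subrK (sv F * sv H)) addrC; congr (_ + _).
  rewrite -[LHS]/(commr _ _) HE FE commrZl d_comm -scaler_nat scalerA -scaleNr.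
  by congr (_ *: _); field.
have Ev : E *: v = 0 by rewrite /E (scale_act _ sab) v_up scaler0.
have Hv : H *: v = (- (\sum_(i <- r) (g%:~R * c i - e * (1 - g%:~R))) / 2)%:A *: v.
  rewrite /H (scale_act _ (\sum_(i <- r) _)).
  have -> : (\sum_(i <- r) (g%:~R *: sd i - (e * (1 - g%:~R))%:A)) *: v =
      (\sum_(i <- r) (g%:~R * c i - e * (1 - g%:~R)))%:A *: v.
    rewrite !scaler_suml big_seq [RHS]big_seq.
    apply: eq_bigr => i ir.
    rewrite scalerBl (scale_act _ (sd i)) v_diag // scale_scale.
    by rewrite -!scalerBl.
  by rewrite scale_scale mulrC mulrA mulrN1.
exact: (sl2_weight_nat centralT ef hf Ev Hv v0 fdV).
Qed.

End Sl2Sub.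

(** * The weight of the highest weight vector *)

Section HighestWeight.
Variables (C : numFieldType) (s : sym_pair).
Notation N := (sp_N s).
Notation X := (Yangian C s).
Notation T := (twYangian C s).
Notation y := (antisym (fun a b => @Yangian_t C s a b 0%N)).
Notation gs a := (gsign s (lab a)).
Notation d := (((sp_p s)%:R - (sp_q s)%:R) / 4 : C).

Lemma twYangian_inj (u v : T) : sub_val u = sub_val v -> u = v.
Proof. exact: val_inj. Qed.

Lemma tw_gen_subproof (i j : 'I_N) :
  Smx C s i j (- 1) \in
    subalg_gen [set z : X | exists i j (r : nat), z = Smx C s i j (Negz r)]%classic.
Proof. by apply/asboolP => B _; apply; exists i, j, 0%N. Qed.

Definition tw_gen i j : T := Subalg (tw_gen_subproof i j).

Lemma tw_genE i j : gs i = gs j ->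
  sub_val (tw_gen i j) = y i j *~ gs i + (d * ((gs i)%:~R - 1))%:A *+ (i == j).
Proof. exact: Smx_coef. Qed.

Variables (mu : nat -> laurent C) (V : lmodType T).
Hypothesis hV : irr_quotient (Verma s mu) V.

(** The vector is the image of the class of 1. That class generates the Verma module, so its image
    in a nonzero quotient is nonzero. *)
Lemma highest_weight_vector : exists v : V, [/\ v != 0,
  (forall i j : 'I_N, (i < j)%N -> tw_gen i j *: v = 0) &
  forall i : 'I_N, 0 <= lab i ->
    tw_gen i i *: v = (mu (absz (lab i)) (- 1))%:A *: v].
Proof.
case: hV => -[[w w0] _] [f f_surj].
pose S := @Verma_relations C s mu.
pose pr (z : T) : Verma s mu := @quot_proj T (T^o) S z.
have prE (z : T) : z *: pr 1 = pr z.
  by have := @quot_scaleE T (T^o) S z 1; rewrite /GRing.scale /= mulr1.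
have pr0 : pr 0 = 0.
  by have := @quot_projB T (T^o) S 0 0; rewrite !subrr.
have rel z : S z -> z *: f (pr 1) = 0.
  move=> Sz; rewrite -linearZ prE -[RHS](linear0 f); congr (f _).
  rewrite -pr0; apply/quot_projP; rewrite subr0.
  by apply/asboolP => W _; apply.
exists (f (pr 1)); split.
- apply: contraNneq w0 => f1; have [m <-] := f_surj w.
  have -> : m = repr m *: pr 1 by rewrite prE /pr quot_proj_repr.
  by rewrite linearZ /= f1 scaler0.
- by move=> i j ij; apply: rel; left; exists i, j, (- 1).
- move=> i i0; apply/eqP; rewrite -subr_eq0 -scalerBl; apply/eqP/rel; right.
  by exists i, (- 1).
Qed.

Lemma highest_weight_nat (a b : 'I_N) (r : seq 'I_N) (g : int) (m : nat) :
  fin_dim V -> (a < b)%N -> gs a = g -> gs b = g ->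
  (forall i, i \in r -> 0 <= lab i /\ gs i = g) ->
  (0 < m)%N ->
  commr (y a b) (y b a) = - (\sum_(i <- r) y i i) *+ m ->
  commr (\sum_(i <- r) y i i) (y b a) = y b a *+ 4 ->
  exists n : nat,
    - (\sum_(i <- r) (g%:~R * mu (absz (lab i)) (- 1) - d * (1 - g%:~R))) / 2 = n%:R.
Proof.
move=> fdV ab ga gb hr m0 yab yH.
have [v [v0 v_up v_diag]] := highest_weight_vector.
have gg : g%:~R * g%:~R = 1 :> C.
  by rewrite -ga /gsign -intrM; case: ifP; case: ifP.
have aNb : (a == b) = false by apply/negbTE; rewrite neq_ltn ab.
have bNa : (b == a) = false by rewrite eq_sym.
have gab : gs a = gs b by rewrite ga gb.
pose sv (z : T) : X := sub_val z.
have svab : sv (tw_gen a b) = y a b *~ g.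
  by rewrite /sv (tw_genE gab) ga aNb mulr0n; exact: addr0.
have svba : sv (tw_gen b a) = y b a *~ g.
  by rewrite /sv (tw_genE (esym gab)) gb bNa mulr0n; exact: addr0.
have svd i : i \in r -> sv (tw_gen i i) = y i i *~ g + (d * (g%:~R - 1))%:A.
  by move=> /hr[_ gi]; rewrite /sv (tw_genE (erefl (gs i))) eqxx mulr1n gi.
have v_diag' i : i \in r -> tw_gen i i *: v = (mu (absz (lab i)) (- 1))%:A *: v.
  by move=> /hr[i0 _]; exact: v_diag.
apply: (sl2_sub_weight_nat (sv := sv) twYangian_inj _ _ _ _ (@Yangian_scalar_central C s)
  gg svab svba svd m0 yab yH (v_up a b ab) v_diag' v0 fdV) => //.
Qed.
End HighestWeight.

(** * Weights of associated tuples *)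

Section Labels.
Variable s : sym_pair.

Lemma labP (i : nat) : (0 < i <= sp_n s)%N -> exists a : 'I_(sp_N s), lab a = i%:Z.
Proof.
(* Position of the label [i]: when the label 0 is omitted, positive labels sit one place lower. *)
move=> /andP[i0 il]; have h : (sp_n s + i - ~~ is_BI (sp_type s) < sp_N s)%N.
  by rewrite /sp_N; case: (is_BI _) => /=; lia.
exists (Ordinal h); rewrite /lab /=; case: (is_BI _) {h} => /=; first by lia.
by case: ifP; lia.
Qed.

Lemma lab_lt (a b : 'I_(sp_N s)) : lab a < lab b -> (a < b)%N.
Proof. by rewrite /lab; case: (is_BI _) => /=; [lia | case: ifP; case: ifP; lia]. Qed.

End Labels.

Section PolyRatio.
Variable C : numFieldType.

(** The subleading coefficient of [p] cancels in the quotient. *)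
Lemma lead2_peval_ratio (p : {poly C}) (z : C) : p \is monic ->
  lead2 (peval p (lvar + lconst z) / peval p lvar) 0 1 (z * (deg p)%:R).
Proof.
move=> pm; have p0 := monic_neq0 pm.
have sz : (size p <= (deg p).+1)%N by rewrite /deg prednK // size_poly_gt0.
have h z' := lead2_peval z' sz.
have h0 : lead2 (peval p lvar) (deg p) p`_(deg p)
    (if deg p is d'.+1 then p`_d' else 0).
  by have := h 0; rewrite rmorph0 addr0 mulr0 mul0r addr0.
move/monicP: pm; rewrite /lead_coef -/(deg p) => p1.
have := lead2_div (h z) h0; rewrite p1 subrr => /(_ (oner_neq0 _)).
congr lead2; rewrite !divr1 ?mulr1 ?mul1r //.
by rewrite addrAC subrr add0r mulrC.
Qed.

(** The leading coefficient of [p(a - u)] is [(-1)^(deg p)], and it must equal 1. *)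
Lemma monic_sym_even (p : {poly C}) (a : C) : p \is monic ->
  p = p \Po (a%:P - 'X) -> deg p = (deg p)./2.*2.
Proof.
move=> pm E; rewrite -[LHS]odd_double_half; suff -> : odd (deg p) = false by [].
apply/negbTE/negP => od.
have : lead_coef p = lead_coef p * (-1) ^+ deg p.
  rewrite {1}E lead_coef_comp; last first.
    rewrite addrC size_polyDl ?size_polyN ?size_polyX // size_polyC.
    by case: (_ != 0).
  congr (_ * _ ^+ _); rewrite addrC lead_coefDl ?lead_coefN ?lead_coefX //.
  by rewrite size_polyN size_polyX size_polyC; case: (_ != 0).
rewrite (monicP pm) -signr_odd od mul1r => /eqP.
by rewrite expr1 -subr_eq0 opprK -[1 + 1]/(2%:R) pnatr_eq0.
Qed.

Lemma lead2_factor (alpha : C) (l : nat) (b : bool) :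
  lead2 (((lconst alpha - lvar) / (lconst alpha + lvar - l%:R)) ^+ b) 0
    ((-1) ^+ b) ((-1) ^+ b * (l%:R - 2 * alpha) *+ b).
Proof.
case: b; last by rewrite !expr0 mulr0n; exact: lead2_1.
rewrite !expr1 mulr1n.
have h1 : lead2 (lconst alpha - lvar) 1 (-1) alpha.
  by have := lead2B (lead2_up (lead2_const alpha)) (lead2_var C); rewrite sub0r subr0.
have h2 : lead2 (lconst alpha + lvar - l%:R) 1 1 (alpha - l%:R).
  have := lead2B (lead2D (lead2_up (lead2_const alpha)) (lead2_var C))
    (lead2_up (lead2_const l%:R)).
  by rewrite rmorph_nat; congr lead2; ring.
have := lead2_div h1 h2 (oner_neq0 _); congr lead2; by field.
Qed.

End PolyRatio.

Section Associated.
Variables (C : numFieldType) (s : sym_pair) (mu : nat -> laurent C).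
Variables (alpha : C) (P : nat -> {poly C}).
Hypothesis hnorm : normalized s mu.
Hypothesis hass : associated s mu alpha P.
Notation n := (sp_n s).
Notation k := (sp_k s).
Notation l := (sp_l s).
Notation u := (@lvar C).
Notation ga i := ((gsign s (i%:Z))%:~R : C).
Notation kap := (kappa C s).
Notation q := ((sp_q s)%:R : C).

(* The number [c] with [tmu_i(u) = 2 g_ii (u + c) + O(u^-1)]. *)
Definition tmu_shift (i : nat) : C :=
  (2 * mu i (- 1) + (i%:R - n%:R) * ga i + \sum_(i.+1 <= j < n.+1) ga j)
  / (2 * ga i).

Lemma ga_neq0 i : ga i != 0.
Proof. by rewrite intr_eq0 /gsign; case: ifP; case: ifP. Qed.

Lemma two_ga_neq0 i : 2 * ga i != 0.
Proof. by rewrite mulf_neq0 ?ga_neq0 // pnatr_eq0. Qed.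

Lemma lead2_mu i : in_INplus s i -> lead2 (mu i) 0 (ga i) (mu i (- 1)).
Proof. by move=> /hnorm[h0 h1]; split. Qed.

Lemma lead2_tmu i : in_INplus s i ->
  lead2 (tmu s mu i) 1 (2 * ga i) (2 * ga i * tmu_shift i).
Proof.
move=> hi; rewrite /tmu.
have h1 : lead2 (2 * u - n%:R + i%:R) 1 2 (i%:R - n%:R).
  have h2 := lead2M (lead2_const (2 : C)) (lead2_var C).
  have := lead2D (lead2B h2 (lead2_up (lead2_const n%:R))) (lead2_up (lead2_const i%:R)).
  by rewrite !rmorph_nat; congr lead2; ring.
have h2 : lead2 (\sum_(i.+1 <= j < n.+1) mu j) 1 0 (\sum_(i.+1 <= j < n.+1) ga j).
  rewrite [X in lead2 X]big_nat_cond [X in lead2 _ _ _ X]big_nat_cond.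
  apply: (@lead2_up _ _ 0); apply: lead2_sum => j /andP[/andP[ij jn] _].
  by apply: lead2_mu; rewrite /in_INplus -ltnS jn /= (leq_ltn_trans _ ij).
have := lead2D (lead2M h1 (lead2_mu hi)) h2.
rewrite /tmu_shift; congr lead2; first by rewrite addr0.
by rewrite [RHS]mulrC divfK ?two_ga_neq0 // addrAC.
Qed.

(** With [c_i] the shift at [i], the ratio is [(g_ii / g_jj)(1 + (c_i - c_j) u^-1 + ...)]: quotients
    of series become differences of shifts. *)
Lemma tmu_shift_sub i j (f : laurent C) (x y : C) :
  in_INplus s i -> in_INplus s j -> tmu s mu i / tmu s mu j = f ->
  lead2 f 0 x (x * y) -> tmu_shift i - tmu_shift j = y.
Proof.
move=> hi hj <- h.
have h' := lead2_div (lead2_tmu hi) (lead2_tmu hj) (two_ga_neq0 j).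
have [e1 e2] := lead2_uniq h' h.
have x0 : x != 0 by rewrite -e1 mulf_neq0 ?invr_neq0 ?two_ga_neq0.
apply: (mulfI x0); rewrite -e2 -e1; field; rewrite ?ga_neq0 //.
Qed.

Lemma lead2_peval_shift (p : {poly C}) (z : C) w : w = lconst z ->
  p \is monic -> lead2 (peval p (u + w) / peval p u) 0 1 (z * (deg p)%:R).
Proof. by move=> ->; exact: lead2_peval_ratio. Qed.

Lemma tmu_shift_step i : (2 <= i <= n)%N ->
  tmu_shift i.-1 - tmu_shift i = (deg (P i))%:R + (l%:R - 2 * alpha) *+ (i == k.+1).
Proof.
move=> hi; have Pm : P i \is monic by apply: (assoc_monic hass); lia.
apply: (tmu_shift_sub _ _ (assoc_step hass hi) (x := (-1) ^+ (i == k.+1))).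
- by rewrite /in_INplus; case: (is_BI _); lia.
- by rewrite /in_INplus; case: (is_BI _); lia.
have := lead2M (lead2_peval_shift (esym (rmorph1 (@lconst C))) Pm)
  (lead2_factor alpha l (i == k.+1)).
by congr lead2; ring.
Qed.

(** Telescoping. The factor with [alpha] enters only at the step into [k+1], and these steps start
    at index 2. *)
Lemma tmu_shift_sum j : (1 <= j <= n)%N -> (j <= k.+1)%N ->
  tmu_shift 1 - tmu_shift j = \sum_(2 <= a < j.+1) (deg (P a))%:R
                + (l%:R - 2 * alpha) *+ ((j == k.+1) && (1 < j)%N).
Proof.
elim: j => [|j IH] //; case: j IH => [|j] IH hj jk.
  by rewrite big_geq // andbF subrr addr0.
have h1 : (1 <= j.+1 <= n)%N by lia.
have h2 : (j.+1 <= k.+1)%N by lia.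
have := IH h1 h2; have := @tmu_shift_step j.+2 _ => /(_ _)/=.
have -> : (j.+1 == k.+1) = false by lia.
move=> H E; rewrite [in RHS]big_nat_recr //= -(subrK (tmu_shift j.+1) (tmu_shift 1)) E.
rewrite -addrA H; last by lia.
by rewrite andbT addr0 addrA.
Qed.

Definition gfun_sign : C := if is_BIb (sp_type s) then -1 else 1.

Lemma gfun_sign_neq0 : gfun_sign != 0.
Proof. by rewrite /gfun_sign; case: ifP; rewrite ?oppr_eq0 oner_eq0. Qed.

(** Here [g(w)] is, up to sign, [1 + 2 q / (p - q - 4 w)], so [b] is invisible at this order. *)
Lemma lead2_gfun w a b : lead2 w 1 a b -> a != 0 ->
  lead2 (gfun s w) 0 gfun_sign (gfun_sign * (- (q / (2 * a)))).
Proof.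
move=> hw a0; set e := gfun_sign.
have h4 : lead2 (4 * w) 1 (4 * a) (4 * b).
  have := lead2M (lead2_const (4 : C)) hw.
  by rewrite rmorph_nat; congr lead2; ring.
have hc (x : C) : lead2 (lconst x - 4 * w) 1 (- (4 * a)) (x - 4 * b).
  by have := lead2B (lead2_up (lead2_const x)) h4; congr lead2; ring.
have d0 : - (4 * a) != 0 by rewrite oppr_eq0 mulf_neq0 // pnatr_eq0.
have he : lead2 (if is_BIb (sp_type s) then -1 else 1 : laurent C) 0 e 0.
  rewrite /e /gfun_sign; case: ifP => _; have := lead2_1 C => //.
  by move/lead2N; rewrite oppr0.
have := lead2M he (lead2_div (hc ((sp_p s)%:R + q)) (hc ((sp_p s)%:R - q)) d0).
rewrite rmorphD rmorphB !rmorph_nat /gfun; congr lead2.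
  by rewrite divff // mulr1.
by field; rewrite a0 -?mulNr; rewrite ?pnatr_eq0.
Qed.


Lemma lead2_refl_var : lead2 (lconst kap - u) 1 (-1) kap.
Proof.
by have := lead2B (lead2_up (lead2_const kap)) (lead2_var C); congr lead2; ring.
Qed.

Lemma lead2_refl_tmu i : in_INplus s i ->
  lead2 (lrefl kap (tmu s mu i)) 1 (2 * ga i * -1) (2 * ga i * (tmu_shift i + kap)).
Proof. by move=> /lead2_tmu/(lead2_lrefl kap); congr lead2; ring. Qed.

Lemma gfun_even_ratio : lead2 (gfun s (lconst kap - u) / gfun s u) 0 1 q.
Proof.
have N0 : (-1 : C) != 0 by rewrite oppr_eq0 oner_eq0.
have := lead2_div (lead2_gfun lead2_refl_var N0)
  (lead2_gfun (lead2_var C) (oner_neq0 _)) gfun_sign_neq0.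
by congr lead2; [rewrite divff ?gfun_sign_neq0 | field; rewrite gfun_sign_neq0].
Qed.

(** Reflection turns [u + c_1] into [-(u - kappa - c_1)], so the two shifts add up; [kappa] cancels
    against the last factor. It is used with [j = 1] in type CII and [j = 2] in type DI(a). *)
Lemma tmu_shift_even j : in_INplus s 1 -> in_INplus s j ->
  lrefl kap (tmu s mu 1) / tmu s mu j
    = gfun s (lconst kap - u) / gfun s u
      * (peval (P 1%N) (u + 2 ^+ sp_delta s) / peval (P 1%N) u)
      * ((lconst kap - u) / u) ->
  tmu_shift 1 + tmu_shift j = - q - 2 ^+ sp_delta s * (deg (P 1%N))%:R.
Proof.
move=> h1 hj E.
have Pm : P 1%N \is monic by apply: (assoc_monic hass); case/andP: h1; lia.
have hL := lead2_div (lead2_refl_tmu h1) (lead2_tmu hj) (two_ga_neq0 j).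
have hu : 2 ^+ sp_delta s = lconst (2 ^+ sp_delta s) :> laurent C.
  by rewrite rmorphXn rmorph_nat.
have hR := lead2M (lead2M gfun_even_ratio (lead2_peval_shift hu Pm))
  (lead2_div lead2_refl_var (lead2_var C) (oner_neq0 _)).
rewrite E in hL; have [e1 e2] := lead2_uniq hL hR.
set D := 2 ^+ _ * _ in e2 *.
(* Comparison of the leading coefficients. *)
have gE : ga 1 = ga j.
  have := congr1 (fun z => z * - ga j) e1.
  have -> : 2 * ga 1 * -1 / (2 * ga j) * - ga j = ga 1 by field; rewrite ga_neq0.
  by move=> ->; field.
have := e2; rewrite gE.
have -> : (2 * ga j * (tmu_shift 1 + kap)
    - 2 * ga j * -1 / (2 * ga j) * (2 * ga j * tmu_shift j)) / (2 * ga j)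
  = tmu_shift 1 + tmu_shift j + kap by field; rewrite ga_neq0.
move=> H; apply: (addIr kap); rewrite H; by field.
Qed.

(** For the shift [c] at 0, the second coefficients give [- q/2 - kappa - c = q/2 - kappa + c]. *)
Lemma tmu_shift_odd0 : is_BI (sp_type s) -> tmu_shift 0 = - (q / 2).
Proof.
move=> BI; have [_ E] := assoc_odd hass BI.
have h0 : in_INplus s 0 by rewrite /in_INplus BI.
have N0 : (-1 : C) != 0 by rewrite oppr_eq0 oner_eq0.
have hL := lead2M (lead2M (lead2_var C) (lead2_gfun (lead2_var C) (oner_neq0 _)))
  (lead2_refl_tmu h0).
have hR := lead2M (lead2M lead2_refl_var (lead2_gfun lead2_refl_var N0)) (lead2_tmu h0).
rewrite E in hL; have [_ e2] := lead2_uniq hL hR.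
apply: (mulfI (_ : 4 * ga 0 * gfun_sign != 0)).
  by rewrite !mulf_neq0 ?ga_neq0 ?gfun_sign_neq0 // pnatr_eq0.
move/eqP: e2; rewrite -subr_eq0 => /eqP e2; apply/eqP; rewrite -subr_eq0; apply/eqP.
by rewrite -[RHS]e2; field.
Qed.

Lemma tmu_shift_odd1 : is_BI (sp_type s) -> (0 < n)%N ->
  tmu_shift 0 - tmu_shift 1 = (deg (P 1%N))%:R / 2 + (n%:R - 2 * alpha) *+ (k == 0%N).
Proof.
move=> BI n0; have [E _] := assoc_odd hass BI.
have Pm : P 1%N \is monic by apply: (assoc_monic hass); lia.
apply: (tmu_shift_sub _ _ E (x := (-1) ^+ (k == 0%N))).
- by rewrite /in_INplus BI.
- by rewrite /in_INplus BI n0.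
have h2 : 1 / 2 = lconst (1 / 2) :> laurent C.
  by rewrite fmorph_div rmorph1 rmorph_nat.
have := lead2M (lead2_peval_shift h2 Pm) (lead2_factor alpha n (k == 0%N)).
by congr lead2; ring.
Qed.

End Associated.

(** * The shift at index [k+1] in terms of [alpha] and the degrees *)

Section TopShift.
Variables (C : numFieldType) (s : sym_pair).
Hypothesis hsp : is_CII (sp_type s) -> (4 <= sp_N s)%N.
Hypothesis hso : ~~ is_CII (sp_type s) -> (5 <= sp_N s)%N /\ sp_q s <> 2%N.
Notation n := (sp_n s).
Notation k := (sp_k s).
Notation l := (sp_l s).
Notation N := (sp_N s).

(** [2 l] is the size of the block [|i| > k]. The bound [1 < l] makes [k+2] an index in the
    orthogonal case; the bound on [k] keeps [alpha] out of the step at index 2 in type DI(a). *)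
Lemma sym_pair_arith :
  [/\ (k + l = n)%N, (sp_p s + sp_q s = N)%N,
     (if is_BIb (sp_type s) then sp_p s else sp_q s) = l.*2
   & [/\ (0 < l)%N, ~~ is_CII (sp_type s) -> (1 < l)%N
   & ~~ is_BI (sp_type s) -> (2 - sp_delta s <= k)%N]].
Proof.
have := sp_q_gt0 s; have := sp_q_le s; have := sp_q_odd s; move: hsp hso.
rewrite /sp_p /sp_k /sp_l /sp_N /sp_delta; case: (sp_type s) => /= h1 h2 od qn q0.
- case: h2 => // h2 h3; split; [lia | lia | lia | split; lia].
- case: h2 => // h2 h3; split; [lia | lia | lia | split; lia].
- move: (h1 isT) => {}h1; split; [lia | lia | lia | split; lia].
- case: h2 => // h2 h3; split; [lia | lia | lia | split; lia].
Qed.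

Notation d := (((sp_p s)%:R - (sp_q s)%:R) / 4 : C).
Notation ga i := ((gsign s (i%:Z))%:~R : C).
Notation g := (if is_BIb (sp_type s) then 1 else -1 : int).

Lemma gsign_high i : (k < i)%N -> gsign s i%:Z = g.
Proof. by rewrite /gsign /= => ki; rewrite leqNgt ki; case: ifP. Qed.

(** Beyond [k] the sign is constant, so the sum over [j > i] cancels the term [(i - n) g]. *)
Lemma tmu_shift_high (mu : nat -> laurent C) i : (k < i <= n)%N ->
  tmu_shift s mu i = g%:~R * mu i (- 1).
Proof.
move=> /andP[ki il]; rewrite /tmu_shift gsign_high //.
have -> : \sum_(i.+1 <= j < n.+1) ga j = (n%:R - i%:R) * g%:~R.
  rewrite (eq_big_nat _ _ (F2 := fun=> g%:~R)) => [|j /andP[ij _]]; last first.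
    by rewrite gsign_high // (ltn_trans ki).
  by rewrite sumr_const_nat subSS -natrB // mulr_natl.
have : g%:~R != 0 :> C by rewrite intr_eq0; case: ifP.
have : g%:~R * g%:~R = 1 :> C by case: ifP => _; rewrite -intrM.
move: (g%:~R : C) => e ee e0.
have eV : e^-1 = e by apply: (mulfI e0); rewrite ee divff.
transitivity (mu i (- 1) / e); first by field.
by rewrite eV mulrC.
Qed.


Section Weights.
Variables (mu : nat -> laurent C) (alpha : C) (P : nat -> {poly C}).
Hypothesis hnorm : normalized s mu.
Hypothesis hass : associated s mu alpha P.
Notation dP a := ((deg (P a))%:R : C).

Definition Adeg_num : C :=
  match sp_type s with
  | CII => dP 1%N
  | DIa => (dP 1%N - dP 2%N) / 2
  | _ => dP 1%N / 2
  end.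

Notation ts := (tmu_shift s mu).

(** The reflection relation pins down the shift at 0 in type BI and at 1 otherwise; the ratios then
    carry it to [k+1]. *)
Lemma tmu_shift_top : ts k.+1 =
  2 * alpha - (sp_q s)%:R / 2 - l%:R - Adeg_num - \sum_(2 <= a < k.+2) dP a.
Proof.
have [kln pqN ql [l0 l1 k1]] := sym_pair_arith.
have hk : (1 <= k.+1 <= n)%N by lia.
have E := tmu_shift_sum hnorm hass hk (leqnn _).
rewrite eqxx /= in E.
have in1 : in_INplus s 1 by rewrite /in_INplus; lia.
have [BI|nBI] := boolP (is_BI (sp_type s)).
  have c0 := tmu_shift_odd0 hnorm hass BI.
  have c1 := tmu_shift_odd1 hnorm hass BI (ltac:(lia) : (0 < n)%N).
  have A1 : Adeg_num = dP 1%N / 2 by rewrite /Adeg_num; case: (sp_type s) BI.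
  rewrite A1; case: (posnP k) => [k0|k_gt0].
    (* For [k = 0] the factor with [alpha] already occurs in the step from 0 to 1, with [n = l]. *)
    rewrite k0 /= in c1 *; rewrite big_geq // subr0.
    have <- : n = l by lia.
    have -> : ts 1 = ts 0 - (ts 0 - ts 1) by ring.
    by rewrite c1 c0 mulr1n; field.
  rewrite ltnS k_gt0 mulr1n in E; rewrite (gtn_eqF k_gt0) mulr0n addr0 in c1.
  have -> : ts k.+1 = ts 0 - (ts 0 - ts 1) - (ts 1 - ts k.+1) by ring.
  by rewrite E c1 c0; field.
have k_gt0 : (0 < k)%N by have := k1 nBI; rewrite /sp_delta; case: (is_CII _) => /=; lia.
rewrite ltnS k_gt0 mulr1n in E.
have -> : ts k.+1 = ts 1 - (ts 1 - ts k.+1) by ring.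
rewrite E.
have [CI|nCI] := boolP (is_CII (sp_type s)).
  have := assoc_even hass nBI; rewrite {1}/sp_delta CI
    => /(tmu_shift_even hnorm hass in1 in1).
  have -> : Adeg_num = dP 1%N by rewrite /Adeg_num; case: (sp_type s) CI.
  rewrite /sp_delta CI => c1; have -> : ts 1 = (ts 1 + ts 1) / 2 by field.
  by rewrite c1; field.
have k_gt1 : (1 < k)%N by have := k1 nBI; rewrite /sp_delta (negPf nCI).
have in2 : in_INplus s 2 by rewrite /in_INplus; lia.
have := assoc_even hass nBI; rewrite {1}/sp_delta (negPf nCI)
  => /(tmu_shift_even hnorm hass in1 in2).
have -> : Adeg_num = (dP 1%N - dP 2%N) / 2.
  by rewrite /Adeg_num; case: (sp_type s) nCI nBI.
rewrite /sp_delta (negPf nCI) => c12.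
have := tmu_shift_step hnorm hass (ltac:(lia) : (2 <= 2 <= n)%N).
rewrite (_ : (2 == k.+1)%N = false) ?mulr0n ?addr0 /=; last by lia.
move=> c12'.
(* In type DI(a) the reflection gives the sum of the first two shifts, and the ratio at index 2
   their difference. *)
have -> : ts 1 = ((ts 1 + ts 2) + (ts 1 - ts 2)) / 2 by field.
by rewrite c12 c12'; field.
Qed.

End Weights.
End TopShift.

(** * Integrality of the weights at [k+1] and [k+2] *)

Section Dominance.
Variables (C : numFieldType) (s : sym_pair).
Hypothesis hsp : is_CII (sp_type s) -> (4 <= sp_N s)%N.
Hypothesis hso : ~~ is_CII (sp_type s) -> (5 <= sp_N s)%N /\ sp_q s <> 2%N.
Variables (mu : nat -> laurent C) (alpha : C) (P : nat -> {poly C}).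
Hypothesis hnorm : normalized s mu.
Hypothesis hass : associated s mu alpha P.
Variable V : lmodType (twYangian C s).
Hypothesis hV : irr_quotient (Verma s mu) V.
Hypothesis fdV : fin_dim V.
Notation n := (sp_n s).
Notation k := (sp_k s).
Notation l := (sp_l s).
Notation N := (sp_N s).
Notation d := (((sp_p s)%:R - (sp_q s)%:R) / 4 : C).
Notation g := (if is_BIb (sp_type s) then 1 else -1 : int).
Notation gs a := (gsign s (lab a)).
Notation dP a := ((deg (P a))%:R : C).
Notation sum_dP := (\sum_(2 <= a < k.+2) dP a).

Lemma gsign_rev (a : 'I_N) : gs (rev_ord a) = gs a.
Proof. by rewrite lab_rev /gsign abszN. Qed.

Lemma lab_rev_lt (a b : 'I_N) : 0 < lab a -> 0 < lab b -> (rev_ord a < b)%N.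
Proof. by move=> a0 b0; apply: lab_lt; rewrite lab_rev; lia. Qed.

Lemma rev_ord_neq (a b : 'I_N) : 0 < lab a -> 0 < lab b -> a != rev_ord b.
Proof.
move=> a0 b0; apply/eqP => /(congr1 (@lab s)); rewrite lab_rev => E.
by move: a0; rewrite E; lia.
Qed.

(** [2 l] is [p] when [g = 1] and [q] when [g = -1]; in both cases the constants add up to
    [- N/2]. *)
Lemma tmu_shift_top_sub : tmu_shift s mu k.+1 - d * (1 - g%:~R) =
  2 * (alpha - N%:R / 4) - Adeg_num s P - sum_dP.
Proof.
have [kln pqN ql _] := sym_pair_arith hsp hso.
rewrite (tmu_shift_top hsp hso hnorm hass) -pqN natrD.
have l2 : l%:R = (if is_BIb (sp_type s) then sp_p s else sp_q s)%:R / 2 :> C.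
  by rewrite ql -muln2 natrM mulfK // pnatr_eq0.
by rewrite l2; case: ifP => _; rewrite ?rmorphN ?rmorph1 /=; field.
Qed.

Lemma weight_symp : is_CII (sp_type s) -> exists m : nat,
  alpha - N%:R / 4 = (dP 1%N + sum_dP) / 2 - m%:R.
Proof.
move=> CI; have [kln pqN ql [l0 _ _]] := sym_pair_arith hsp hso.
have hk : (0 < k.+1 <= n)%N by lia.
have [i labi] := @labP s k.+1 hk.
have i0 : 0 < lab i by rewrite labi.
have gi : gs i = g by rewrite labi gsign_high.
have th a b : @theta s a b = sgz (lab a) * sgz (lab b) by rewrite /theta CI.
have [e1 e2] := sl2_symp (@Yangian_comm_rel C s) th i0 (rev_ord_neq i0 i0).
have gi' : gs (rev_ord i) = g by rewrite gsign_rev.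
have hr j : j \in [:: i] -> 0 <= lab j /\ gs j = g.
  by rewrite inE => /eqP->; split=> //; exact: ltW.
have := @highest_weight_nat C s mu V hV (rev_ord i) i [:: i] g 8 fdV
  (lab_rev_lt i0 i0) gi' gi hr isT.
rewrite !big_seq1 labi absz_nat => /(_ e1 e2)[m hm]; exists m.
have := tmu_shift_top_sub; rewrite tmu_shift_high ?ltnSn ?hk //.
have -> : Adeg_num s P = dP 1%N by rewrite /Adeg_num; case: (sp_type s) CI.
(* [w] is the eigenvalue of [y_ii], and [hm] amounts to [w = - 2 m]. *)
set w := _ - d * _ in hm * => E.
have -> : alpha - N%:R / 4 = (w + dP 1%N + sum_dP) / 2 by rewrite E; field.
by rewrite -hm; field.
Qed.

Lemma weight_orth : ~~ is_CII (sp_type s) -> exists m : nat,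
  2 * (alpha - N%:R / 4) = Adeg_num s P + sum_dP + dP k.+2 / 2 - m%:R.
Proof.
move=> nCI; have [kln pqN ql [_ l1 _]] := sym_pair_arith hsp hso.
have {}l1 := l1 nCI.
have hki : (0 < k.+1 <= n)%N by lia.
have hkj : (0 < k.+2 <= n)%N by lia.
have [i labi] := @labP s k.+1 hki; have [j labj] := @labP s k.+2 hkj.
have i0 : 0 < lab i by rewrite labi.
have j0 : 0 < lab j by rewrite labj.
have gi : gs i = g by rewrite labi gsign_high.
have gj : gs j = g by rewrite labj gsign_high // ltnW.
have ij : i != j by apply/eqP => /(congr1 (@lab s)); rewrite labi labj; lia.
have th a b : @theta s a b = 1 by rewrite /theta (negPf nCI).
have [e1 e2] := sl2_orth (@Yangian_comm_rel C s) th ij (rev_ord_neq i0 i0)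
  (rev_ord_neq j0 j0) (rev_ord_neq i0 j0).
have gj' : gs (rev_ord j) = g by rewrite gsign_rev.
have hr a : a \in [:: i; j] -> 0 <= lab a /\ gs a = g.
  by rewrite !inE => /orP[]/eqP->; split=> //; exact: ltW.
have := @highest_weight_nat C s mu V hV (rev_ord j) i [:: i; j] g 2 fdV
  (lab_rev_lt j0 i0) gj' gi hr isT.
have sumE (B : nmodType) (F : 'I_N -> B) : \sum_(a <- [:: i; j]) F a = F i + F j.
  by rewrite big_cons big_seq1.
rewrite !sumE labi labj !absz_nat => /(_ e1 e2)[m hm]; exists m.
have := tmu_shift_step hnorm hass (ltac:(lia) : (2 <= k.+2 <= n)%N).
rewrite (_ : (k.+2 == k.+1)%N = false) ?mulr0n ?addr0 /=; last by lia.
have := tmu_shift_top_sub; rewrite !tmu_shift_high; [|lia|lia].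
(* [w] is the eigenvalue of [y_ii]; by [E2] that of [y_jj] is [w - deg P_{k+2}], and [hm] says that
   they sum to [- 2 m]. *)
set w := _ - d * _ => E1 E2.
have -> : 2 * (alpha - N%:R / 4) = w + Adeg_num s P + sum_dP by rewrite E1; ring.
by rewrite -hm -E2 /w; field.
Qed.

End Dominance.

(** * Parity of the degrees and the final bound *)

Lemma assoc_deg_even (C : numFieldType) (s : sym_pair) mu (alpha : C) P i :
  associated s mu alpha P -> (1 <= i <= sp_n s)%N -> deg (P i) = (deg (P i))./2.*2.
Proof.
move=> hass hi; have Pm := assoc_monic hass hi.
have [i2|] := leqP 2 i; last first.
  move=> i1; have -> : i = 1%N by lia.
  have -> : 1%N = i by lia.
  by apply: monic_sym_even => //; have -> : i = 1%N by [lia|]; exact: assoc_sym1 hass.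
by apply: monic_sym_even => //; apply: (assoc_sym hass); lia.
Qed.

Theorem proposition4p12 (R : realType) (s : sym_pair)
    (hsp : is_CII (sp_type s) -> (4 <= sp_N s)%N)
    (hso : ~~ is_CII (sp_type s) -> (5 <= sp_N s)%N /\ sp_q s <> 2%N)
    (mu : nat -> laurent R[i]) (alpha : R[i]) (P : nat -> {poly R[i]})
    (mu_normalized : normalized s mu)
    (mu_associated : associated s mu alpha P)
    (V : lmodType (twYangian R[i] s))
    (V_irr_quotient : irr_quotient (Verma s mu) V)
    (V_fin_dim : fin_dim V) :
  exists z : int,
    2 ^+ (1 - sp_delta s) * (alpha - (sp_N s)%:R / 4) = z%:~R
    /\ z%:~R <= Adeg s P
                + \sum_(2 <= a < (sp_k s).+2) (deg (P a))%:R
                + (1 - 2 ^ ((sp_delta s)%:Z - 1)) * (deg (P (sp_k s).+2))%:R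
        :> rat.
Proof.
have [kln _ _ [l0 l1 _]] := sym_pair_arith hsp hso.
have ev i := assoc_deg_even (i := i) mu_associated.
pose e i := (deg (P i))./2.
pose D := (\sum_(2 <= a < (sp_k s).+2) e a)%N.
have sumD (F : comNzRingType) :
    \sum_(2 <= a < (sp_k s).+2) (deg (P a))%:R = 2 * D%:R :> F.
  rewrite /D natr_sum mulr_sumr; apply: eq_big_nat => a ha.
  by rewrite ev; [rewrite -muln2 natrM mulrC | lia].
have evR (F : comNzRingType) i :
    (1 <= i <= sp_n s)%N -> (deg (P i))%:R = 2 * (e i)%:R :> F.
  by move=> hi; rewrite ev // -muln2 natrM mulrC.
have hn : (0 < sp_n s)%N by lia.
have [CI|nCI] := boolP (is_CII (sp_type s)).
  have [m E] := weight_symp hsp hso mu_normalized mu_associated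
    V_irr_quotient V_fin_dim CI.
  (* Half the sum of the degrees is [e 1 + D]. The bound equals [2 (e 1 + D)], so nonnegativity of
     [e 1], [D] and [m] suffices. *)
  exists ((e 1%N + D)%:Z - m%:Z); rewrite /sp_delta CI expr0 mul1r; split.
    rewrite E sumD evR // rmorphB /= -!pmulrn natrD.
    by field.
  have -> : Adeg s P = (deg (P 1%N))%:R by rewrite /Adeg; case: (sp_type s) CI.
  have -> : 2 ^ (true%:Z - 1) = 1 :> rat by [].
  rewrite sumD evR // subrr mul0r addr0 rmorphB /= -!pmulrn natrD.
  have := ler0n rat (e 1%N); have := ler0n rat D; have := ler0n rat m; lra.
have [m E] := weight_orth hsp hso mu_normalized mu_associated
  V_irr_quotient V_fin_dim nCI.
(* [a] is the value of [A] as an integer, available because the degrees are even. *)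
pose a : int := if is_BI (sp_type s) then (e 1%N)%:Z else (e 1%N)%:Z - (e 2%N)%:Z.
have k2 : (1 <= (sp_k s).+2 <= sp_n s)%N by have := l1 nCI; lia.
have hn2 : (2 <= sp_n s)%N by lia.
(* The last coefficient is [1/2] here, so the bound exceeds this integer by exactly [m]. *)
exists (a + (2 * D + e (sp_k s).+2)%:Z - m%:Z).
rewrite /sp_delta (negPf nCI) subn0 expr1; split.
  rewrite E sumD (evR _ _ k2).
  have -> : Adeg_num s P = a%:~R.
    rewrite /Adeg_num /a; case: (sp_type s) nCI => //= _; rewrite !evR ?hn2 //.
    - by rewrite -pmulrn; field.
    - by rewrite -pmulrn; field.
    - by rewrite rmorphB /= -!pmulrn; field.
  by rewrite rmorphB rmorphD /= -!pmulrn natrD natrM; field.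
have -> : Adeg s P = a%:~R.
  rewrite /Adeg /a; case: (sp_type s) nCI => //= _; rewrite !evR ?hn2 //.
  - by rewrite -pmulrn; field.
  - by rewrite -pmulrn; field.
  - by rewrite rmorphB /= -!pmulrn; field.
rewrite sumD (evR _ _ k2) rmorphB rmorphD /= -!pmulrn natrD natrM sub0r exprN1.
have := ler0n rat m; lra.
Qed.
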